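(* Let $n\ge 2$ and $q\in K^*$. The bialgebra $UT_q(n)$ is a Hopf algebra.
   Context: $K$ is a field of characteristic different from $2$; tensor products and algebras are over $K$; $K^*=K\setminus\{0\}$. For $n\ge 2$ and $q\in K^*$, $T_q(n)$ is the unital associative $K$-algebra with generators $a_{ij}$, $1\le i\le j\le n$, and defining relations: $a_{jk}a_{ik}=q\,a_{ik}a_{jk}$ for $i<j\le k$; $a_{jk}a_{jl}=q\,a_{jl}a_{jk}$ for $j\le k<l$; $a_{ik}a_{jl}=a_{jl}a_{ik}$ for $i<j\le l$, $i\le k<l$; $a_{jk}a_{il}=q^2a_{il}a_{jk}$ for $i<j\le k<l$. It is a domain, and a bialgebra with comultiplication $\Delta(a_{ij})=\sum_{k=i}^j a_{ik}\otimes a_{kj}$ and counit $\varepsilon(a_{ij})=\delta_{ij}$. Put $\det_q(n)=\prod_{i=1}^n a_{ii}$ (the $a_{ii}$ commute with each other); it satisfies $\det_q(n)\,a_{ij}=q^{2(j-i)}a_{ij}\det_q(n)$. $UT_q(n):=T_q(n)[\det_q(n)^{-1}]$ is the localization of $T_q(n)$ at the powers of $\det_q(n)$; the bialgebra structure of $T_q(n)$ extends to $UT_q(n)$ with $\det_q(n)^{-1}$ group-like, i.e. $\Delta(\det_q(n)^{-1})=\det_q(n)^{-1}\otimes\det_q(n)^{-1}$ and $\varepsilon(\det_q(n)^{-1})=1$. *)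

(* Defs.v *)
From HB Require Import structures.
From mathcomp Require Import all_boot all_algebra.
From mathcomp Require Import boolp classical_sets.

Set Implicit Arguments.
Unset Strict Implicit.
Unset Printing Implicit Defensive.

Import GRing.Theory.
Local Open Scope quotient_scope.
Local Open Scope ring_scope.

Section Functional.
Variables (K : fieldType) (V : lmodType K) (v : V).
Hypothesis v_neq0 : v != 0.

Lemma exists_functional : exists f : {linear V -> K^o}, f v = 1.
Proof.
pose P (U : set V) :=
  (forall c x y, U x -> U y -> U (c *: x + y)) /\ ~ U v.
have [F FP Ftot|U [[Ulin Uv] Umax]] := @Zorn_bigcup V P.
  split=> [c x y [X FX Xx] [Y FY Yy]|[X FX Xv]]; last by case: (FP X FX).
  have [XY|YX] := Ftot X Y FX FY.
    by exists Y => //; apply: (FP Y FY).1 => //; apply: XY.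
  by exists X => //; apply: (FP X FX).1 => //; apply: YX.
have U0 : U 0.
  apply: contrapT => NU0.
  apply: (Umax [set x | x = 0])%classic; last first.
    split=> [c x y -> ->|/= v0]; first by rewrite /= scaler0 addr0.
    by move: v_neq0; rewrite v0 eqxx.
  have UE x : ~ U x.
    by move=> Ux; apply: NU0; rewrite -(addNr x) -scaleN1r; apply: Ulin.
  split; first by move=> x /UE.
  by move=> H; apply: NU0; apply: H.
have UZ c x : U x -> U (c *: x) by move=> Ux; rewrite -[_ *: _]addr0; apply: Ulin.
have UD x y : U x -> U y -> U (x + y).
  by move=> Ux Uy; rewrite -[x]scale1r; apply: Ulin.
have UN x : U x -> U (- x) by rewrite -scaleN1r; apply: UZ.
have ex x : exists a : K^o, U (x - a *: v).
  have [Ux|Ux] := pselect (U x); first by exists 0; rewrite scale0r subr0.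
  apply: contrapT => Nex.
  apply: (Umax [set y | exists2 u, U u & exists c, y = u + c *: x])%classic.
    split=> [y Uy|H]; first by exists y => //; exists 0; rewrite scale0r addr0.
    apply: Ux; apply: H.
    by exists 0 => //; exists 1; rewrite scale1r add0r.
  split=> [c y z [u Uu [d ->]] [u' Uu' [d' ->]]|[u Uu [c vE]]].
    exists (c *: u + u'); first exact: Ulin.
    by exists (c * d + d'); rewrite scalerDr scalerDl scalerA addrACA.
  have c0 : c != 0.
    by apply: contra_notN Uv => /eqP c0; rewrite vE c0 scale0r addr0.
  apply: Nex; exists c^-1; rewrite vE scalerDr scalerA mulVf // scale1r.
  by rewrite opprD addrCA subrr addr0; apply/UN/UZ.
have uniq x a b : U (x - a *: v) -> U (x - b *: v) -> a = b.
  move=> Ua Ub; apply/eqP; rewrite -subr_eq0; apply: contra_notT Uv => ab.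
  rewrite -[v](scalerK ab) scalerBl.
  have -> : a *: v - b *: v = (x - b *: v) + - (x - a *: v).
    by rewrite opprB [RHS]addrC addrA subrK.
  by apply/UZ/UD => //; apply: UN.
have [f fP] := choice ex.
have flin : linear f.
  move=> c x y; apply: (uniq (c *: x + y)) => //.
  have -> : c *: x + y - (c *: f x + f y) *: v
          = c *: (x - f x *: v) + (y - f y *: v).
    by rewrite scalerDl opprD scalerBr scalerA addrACA.
  exact: Ulin.
pose m := GRing.isLinear.Build K V K^o *%R f flin.
pose g : {linear V -> K^o} := HB.pack f m.
exists g; apply: (uniq v); first exact: fP.
by rewrite scale1r subrr.
Qed.

End Functional.

Section Tensor.
Variables (K : fieldType) (V W : lmodType K).

(* The sequence [:: (v1, w1); ...; (vr, wr)] stands for the formal sum         *)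
(* v1 ⊗ w1 + ... + vr ⊗ wr; tensor_eq is the smallest congruence making        *)
(* (v, w) |-> v ⊗ w bilinear.                                                 *)
Inductive tensor_eq : seq (V * W) -> seq (V * W) -> Prop :=
| tensor_refl s : tensor_eq s s
| tensor_sym s t : tensor_eq s t -> tensor_eq t s
| tensor_trans s t u : tensor_eq s t -> tensor_eq t u -> tensor_eq s u
| tensor_cat s s' t t' :
    tensor_eq s s' -> tensor_eq t t' -> tensor_eq (s ++ t) (s' ++ t')
| tensor_catC s t : tensor_eq (s ++ t) (t ++ s)
| tensor_addl v v' w : tensor_eq [:: (v + v', w)] [:: (v, w); (v', w)]
| tensor_addr v w w' : tensor_eq [:: (v, w + w')] [:: (v, w); (v, w')]
| tensor_scale c v w : tensor_eq [:: (c *: v, w)] [:: (v, c *: w)]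
| tensor_zero w : tensor_eq [:: (0, w)] [::].

Definition tensor_eqb (s t : seq (V * W)) : bool := `[< tensor_eq s t >].

Lemma tensor_eqb_refl : reflexive tensor_eqb.
Proof. by move=> s; apply/asboolP/tensor_refl. Qed.
Lemma tensor_eqb_sym : symmetric tensor_eqb.
Proof. by move=> s t; apply/asboolP/asboolP; apply: tensor_sym. Qed.
Lemma tensor_eqb_trans : transitive tensor_eqb.
Proof.
move=> t s u /asboolP st /asboolP tu; apply/asboolP.
exact: tensor_trans st tu.
Qed.
Canonical tensor_equiv :=
  EquivRel tensor_eqb tensor_eqb_refl tensor_eqb_sym tensor_eqb_trans.

Definition tensor := {eq_quot tensor_equiv}.
HB.instance Definition _ := Choice.on tensor.
HB.instance Definition _ := EqQuotient.on tensor.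

Lemma tensor_eqP s t : reflect (\pi_tensor s = \pi_tensor t) `[< tensor_eq s t >].
Proof. exact: eqmodP. Qed.

Lemma tensor_pi_eq s t : tensor_eq s t -> \pi_tensor s = \pi_tensor t.
Proof. by move=> st; apply/tensor_eqP/asboolP. Qed.

Lemma tensor_repr s : tensor_eq (repr (\pi_tensor s)) s.
Proof. by apply/asboolP/tensor_eqP; rewrite reprK. Qed.

Definition pure (v : V) (w : W) : tensor := \pi_tensor [:: (v, w)].
Definition tensor_scal (c : K) (s : seq (V * W)) := [seq (c *: p.1, p.2) | p <- s].

Definition tzero : tensor := \pi_tensor [::].
Definition tadd := lift_op2 tensor cat.
Definition tscale (c : K) := lift_op1 tensor (tensor_scal c).
Definition topp (x : tensor) : tensor := tscale (-1) x.

Lemma tensor_scal_eq c s t :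
  tensor_eq s t -> tensor_eq (tensor_scal c s) (tensor_scal c t).
Proof.
elim=> {s t} [s|s t _ IH|s t u _ IH _ IH'|s s' t t' _ IH _ IH'|s t|v v' w|v w w'
  |d v w|w] /=.
- exact: tensor_refl.
- exact: tensor_sym.
- exact: tensor_trans IH IH'.
- by rewrite /tensor_scal !map_cat; apply: tensor_cat.
- by rewrite /tensor_scal !map_cat; apply: tensor_catC.
- by rewrite scalerDr; apply: tensor_addl.
- exact: tensor_addr.
- by rewrite scalerA mulrC -scalerA; apply: tensor_scale.
- by rewrite scaler0; apply: tensor_zero.
Qed.

Lemma pi_tadd s t : \pi_tensor (s ++ t) = tadd (\pi_tensor s) (\pi_tensor t).
Proof.
by unlock tadd; apply/esym/tensor_pi_eq/tensor_cat; apply: tensor_repr.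
Qed.

Lemma pi_tscale c s : \pi_tensor (tensor_scal c s) = tscale c (\pi_tensor s).
Proof.
by unlock tscale; apply/esym/tensor_pi_eq/tensor_scal_eq/tensor_repr.
Qed.

Lemma taddA : associative tadd.
Proof.
elim/quotW=> x; elim/quotW=> y; elim/quotW=> z.
by rewrite -!pi_tadd catA.
Qed.

Lemma taddC : commutative tadd.
Proof. by move=> x y; unlock tadd; apply/tensor_pi_eq/tensor_catC. Qed.

Lemma tadd0 : left_id tzero tadd.
Proof. by elim/quotW=> x; rewrite -pi_tadd. Qed.

Lemma tscale1 : left_id 1 tscale.
Proof.
elim/quotW=> x; rewrite -pi_tscale; congr (\pi_tensor _).
by elim: x => //= -[v w] s ->; rewrite scale1r.
Qed.

Lemma tscaleA a b x : tscale a (tscale b x) = tscale (a * b) x.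
Proof.
elim/quotW: x => x; rewrite -!pi_tscale; congr (\pi_tensor _).
by rewrite /tensor_scal -map_comp; apply: eq_map => p /=; rewrite scalerA.
Qed.

Lemma tscaleDr : right_distributive tscale tadd.
Proof.
move=> c; elim/quotW=> x; elim/quotW=> y; rewrite -pi_tadd -!pi_tscale -pi_tadd.
by rewrite /tensor_scal map_cat.
Qed.

Lemma tscaleDl x : {morph (fun c => tscale c x) : a b / a + b >-> tadd a b}.
Proof.
move=> a b; elim/quotW: x => x; rewrite -!pi_tscale.
elim: x => [|[v w] s IH]; first by rewrite -pi_tadd.
rewrite /= -[X in \pi_tensor X]cat1s -[X in tadd (\pi_tensor X)]cat1s.
rewrite -[X in tadd _ (\pi_tensor X)]cat1s !pi_tadd IH.
have -> : \pi_tensor [:: ((a + b) *: v, w)]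
        = tadd (\pi_tensor [:: (a *: v, w)]) (\pi_tensor [:: (b *: v, w)]).
  by rewrite scalerDl -pi_tadd; apply/tensor_pi_eq/tensor_addl.
by rewrite !taddA; congr tadd; rewrite -!taddA; congr tadd; apply: taddC.
Qed.

Lemma tscale0 x : tscale 0 x = tzero.
Proof.
elim/quotW: x => x; rewrite -pi_tscale.
elim: x => [//|[v w] s IH] /=.
rewrite -cat1s pi_tadd IH scale0r.
by rewrite (tensor_pi_eq (tensor_zero w)); apply: tadd0.
Qed.

Lemma taddN : left_inverse tzero topp tadd.
Proof.
move=> x; rewrite /topp -[X in tadd _ X](tscale1) -tscaleDl addNr.
exact: tscale0.
Qed.

HB.instance Definition _ :=
  GRing.isZmodule.Build tensor taddA taddC tadd0 taddN.
HB.instance Definition _ :=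
  GRing.Zmodule_isLmodule.Build K tensor tscaleA tscale1 tscaleDr tscaleDl.

Lemma pureDl w : {morph pure^~ w : v v' / v + v'}.
Proof.
move=> v v'; rewrite [RHS]/GRing.add /= -pi_tadd.
by apply/tensor_pi_eq/tensor_addl.
Qed.

Lemma pureDr v : {morph pure v : w w' / w + w'}.
Proof.
move=> w w'; rewrite [RHS]/GRing.add /= -pi_tadd.
by apply/tensor_pi_eq/tensor_addr.
Qed.

Lemma pureZl c v w : pure (c *: v) w = c *: pure v w.
Proof. by rewrite [RHS]/GRing.scale /= -pi_tscale. Qed.

Lemma pureZr c v w : pure v (c *: w) = c *: pure v w.
Proof. by rewrite -pureZl; apply/esym/tensor_pi_eq/tensor_scale. Qed.

Lemma tensorE (x : tensor) : x = \sum_(p <- repr x) pure p.1 p.2.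
Proof.
rewrite -[LHS]reprK; elim: (repr x) => [|[v w] s IH]; first by rewrite big_nil.
by rewrite big_cons -IH -cat1s pi_tadd.
Qed.

Section Lift.
Variable U : lmodType K.

Definition bilin (f : V -> W -> U) :=
  (forall w, linear (f^~ w)) /\ (forall v, linear (f v)).

(* For f bilinear, the unique linear map sending v ⊗ w to f v w (tlift_pure,   *)
(* tlift_linear); it is not meaningful otherwise.                             *)
Definition tlift (f : V -> W -> U) (x : tensor) : U :=
  \sum_(p <- repr x) f p.1 p.2.

Variable f : V -> W -> U.
Hypothesis fbil : bilin f.

Lemma bilinDl v v' w : f (v + v') w = f v w + f v' w.
Proof. by have := fbil.1 w 1 v v'; rewrite !scale1r. Qed.
Lemma bilinDr v w w' : f v (w + w') = f v w + f v w'.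
Proof. by have := fbil.2 v 1 w w'; rewrite !scale1r. Qed.
Lemma bilin0l w : f 0 w = 0.
Proof. by apply: (addrI (f 0 w)); rewrite -bilinDl !addr0. Qed.
Lemma bilin0r v : f v 0 = 0.
Proof. by apply: (addrI (f v 0)); rewrite -bilinDr !addr0. Qed.
Lemma bilinZl c v w : f (c *: v) w = c *: f v w.
Proof. by have := fbil.1 w c v 0; rewrite !addr0 bilin0l addr0. Qed.
Lemma bilinZr c v w : f v (c *: w) = c *: f v w.
Proof. by have := fbil.2 v c w 0; rewrite !addr0 bilin0r addr0. Qed.

Lemma tensor_eq_sum s t : tensor_eq s t ->
  \sum_(p <- s) f p.1 p.2 = \sum_(p <- t) f p.1 p.2.
Proof.
elim=> {s t} [s|s t _ IH|s t u _ IH _ IH'|s s' t t' _ IH _ IH'|s t|v v' w|v w w'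
  |d v w|w] //=.
- by rewrite IH.
- by rewrite !big_cat IH IH'.
- by rewrite !big_cat /= addrC.
- by rewrite !big_cons !big_nil /= !addr0 bilinDl.
- by rewrite !big_cons !big_nil /= !addr0 bilinDr.
- by rewrite !big_cons !big_nil /= !addr0 bilinZl bilinZr.
- by rewrite !big_cons !big_nil /= !addr0 bilin0l.
Qed.

Lemma tlift_pi s : tlift f (\pi_tensor s) = \sum_(p <- s) f p.1 p.2.
Proof. exact/tensor_eq_sum/tensor_repr. Qed.

Lemma tlift_pure v w : tlift f (pure v w) = f v w.
Proof. by rewrite tlift_pi big_cons big_nil addr0. Qed.

Lemma tlift_linear : linear (tlift f).
Proof.
move=> c; elim/quotW=> x; elim/quotW=> y.
rewrite [X in tlift _ X](_ : _ = \pi_tensor (tensor_scal c x ++ y)).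
  rewrite !tlift_pi big_cat big_map scaler_sumr; congr (_ + _).
  by apply: eq_bigr => p _ /=; rewrite bilinZl.
by rewrite pi_tadd pi_tscale.
Qed.

End Lift.

Lemma tlift_ext (U : lmodType K) (f g : V -> W -> U) : f =2 g -> tlift f =1 tlift g.
Proof. by move=> fg x; apply: eq_bigr => p _. Qed.

Lemma tensor_ext (U : lmodType K) (f g : tensor -> U) :
    linear f -> linear g -> (forall v w, f (pure v w) = g (pure v w)) ->
  f =1 g.
Proof.
move=> fl gl fg x.
pose mf := GRing.isLinear.Build K tensor U *:%R f fl.
pose mg := GRing.isLinear.Build K tensor U *:%R g gl.
pose f' : {linear tensor -> U} := HB.pack f mf.
pose g' : {linear tensor -> U} := HB.pack g mg.
rewrite -[f]/(f' : _ -> _) -[g]/(g' : _ -> _) (tensorE x) !linear_sum.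
by apply: eq_bigr => p _; apply: fg.
Qed.

Lemma pure_bilin : bilin pure.
Proof.
by split=> [w c v v'|v c w w'];
  rewrite ?pureDl ?pureDr ?pureZl ?pureZr.
Qed.

End Tensor.

Notation "V ⊗ W" := (tensor V%type W%type)
  (at level 40, left associativity) : type_scope.
Notation "v ⊗ w" := (pure v w)
  (at level 40, left associativity) : ring_scope.

Section TensorMaps.
Variable K : fieldType.

Definition tensor_map (V V' W W' : lmodType K) (f : V -> V') (g : W -> W')
  : V ⊗ W -> V' ⊗ W' := tlift (fun v w => (f v ⊗ g w)%R).

Definition tensor_assoc (U V W : lmodType K) : (U ⊗ V) ⊗ W -> U ⊗ (V ⊗ W) :=
  tlift (fun x w => tlift (fun u v => (u ⊗ (v ⊗ w))%R) x).

Lemma tlift_sum_bilin (U V W : lmodType K) (P : lmodType K)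
    (f : W -> U -> V -> P) (x : U ⊗ V) :
  (forall u v, linear (fun w => f w u v)) -> linear (fun w => tlift (f w) x).
Proof.
move=> fl c w w'; rewrite /tlift scaler_sumr -big_split /=.
by apply: eq_bigr => p _; rewrite fl.
Qed.

Lemma tensor_map_bilin (V V' W W' : lmodType K) (f : V -> V') (g : W -> W') :
  linear f -> linear g -> bilin (fun v w => (f v ⊗ g w)%R).
Proof.
by move=> fl gl; split=> [w c v v'|v c w w']; rewrite ?fl ?gl;
  rewrite ?pureDl ?pureDr ?pureZl ?pureZr.
Qed.

Lemma tensor_map_linear (V V' W W' : lmodType K) (f : V -> V') (g : W -> W') :
  linear f -> linear g -> linear (tensor_map f g).
Proof. by move=> fl gl; apply/tlift_linear/tensor_map_bilin. Qed.

Lemma tensor_mapE (V V' W W' : lmodType K) (f : V -> V') (g : W -> W') v w :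
  linear f -> linear g -> tensor_map f g (v ⊗ w) = f v ⊗ g w.
Proof. by move=> fl gl; apply/tlift_pure/tensor_map_bilin. Qed.

Lemma pure0l (V W : lmodType K) (w : W) : (0 : V) ⊗ w = 0.
Proof. by rewrite -[X in X ⊗ _](scale0r 0) pureZl scale0r. Qed.

Lemma pure0r (V W : lmodType K) (v : V) : v ⊗ (0 : W) = 0.
Proof. by rewrite -[X in _ ⊗ X](scale0r 0) pureZr scale0r. Qed.

Lemma pure_suml (V W : lmodType K) (I : Type) (r : seq I) (F : I -> V) (w : W) :
  (\sum_(i <- r) F i) ⊗ w = \sum_(i <- r) (F i ⊗ w)%R.
Proof.
by rewrite (big_morph (fun v => (v ⊗ w)%R) (pureDl w) (pure0l _ _)).
Qed.

Lemma pure_sumr (V W : lmodType K) (I : Type) (r : seq I) (F : I -> W) (v : V) :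
  v ⊗ (\sum_(i <- r) F i) = \sum_(i <- r) (v ⊗ F i)%R.
Proof.
by rewrite (big_morph (fun w => (v ⊗ w)%R) (pureDr v) (pure0r _ _)).
Qed.

Lemma tensor_map_pure (V V' W W' : lmodType K) (f : {linear V -> V'})
    (g : {linear W -> W'}) v w : tensor_map f g (v ⊗ w) = f v ⊗ g w.
Proof. by rewrite tensor_mapE //; apply: linearP. Qed.

Lemma tensor_assoc_bilin0 (U V W : lmodType K) (w : W) :
  bilin (fun (u : U) (v : V) => (u ⊗ (v ⊗ w))%R).
Proof.
split=> [v c u u'|u c v v'].
  by rewrite pureDl pureZl.
by rewrite pureDl pureZl pureDr pureZr.
Qed.

Lemma tensor_assoc_bilin (U V W : lmodType K) :
  bilin (fun (x : U ⊗ V) (w : W) => tlift (fun u v => (u ⊗ (v ⊗ w))%R) x).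
Proof.
split=> [w|x]; first exact/tlift_linear/tensor_assoc_bilin0.
by apply: tlift_sum_bilin => u v c w w'; rewrite !(pureDr, pureZr).
Qed.

Lemma tensor_assoc_linear (U V W : lmodType K) : linear (@tensor_assoc U V W).
Proof. exact/tlift_linear/tensor_assoc_bilin. Qed.

Lemma tensor_assocE (U V W : lmodType K) (u : U) (v : V) (w : W) :
  tensor_assoc ((u ⊗ v) ⊗ w) = u ⊗ (v ⊗ w).
Proof.
rewrite /tensor_assoc tlift_pure; last exact: tensor_assoc_bilin.
by rewrite tlift_pure; last exact: tensor_assoc_bilin0.
Qed.

End TensorMaps.

Section TensorAlgebra.
Variables (K : fieldType) (A B : algType K).

Definition tone : A ⊗ B := (1 ⊗ 1)%R.
Definition tmul (x y : A ⊗ B) : A ⊗ B :=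
  tlift (fun a b => tlift (fun a' b' => ((a * a') ⊗ (b * b'))%R) y) x.

Lemma tmul_bilin0 (a : A) (b : B) :
  bilin (fun a' b' => ((a * a') ⊗ (b * b'))%R).
Proof.
apply: tensor_map_bilin => c x y; rewrite mulrDr scalerAr //.
Qed.

Lemma tmul_bilin1 (y : A ⊗ B) :
  bilin (fun a b => tlift (fun a' b' => ((a * a') ⊗ (b * b'))%R) y).
Proof.
split=> [b|a]; apply: tlift_sum_bilin => a' b' c x z;
  by rewrite mulrDl -scalerAl !(pureDl, pureDr, pureZl, pureZr).
Qed.

Lemma tmul_linearl y : linear (tmul^~ y).
Proof. exact/tlift_linear/tmul_bilin1. Qed.

Lemma tmul_linearr x : linear (tmul x).
Proof.
move=> c y z; rewrite /tmul [tlift _ x]/tlift scaler_sumr -big_split /=.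
by apply: eq_bigr => p _; rewrite tlift_linear //; apply: tmul_bilin0.
Qed.

Lemma tmul_pure a b a' b' : tmul (a ⊗ b) (a' ⊗ b') = (a * a') ⊗ (b * b').
Proof.
rewrite /tmul tlift_pure; last exact: tmul_bilin1.
by rewrite tlift_pure; last exact: tmul_bilin0.
Qed.

Lemma linear_comp2 (P Q R : lmodType K) (f : P -> Q) (g : Q -> R) :
  linear f -> linear g -> linear (fun x => g (f x)).
Proof. by move=> fl gl c x y; rewrite fl gl. Qed.

Lemma linear_id2 (P : lmodType K) : linear (fun x : P => x).
Proof. by []. Qed.

Lemma tmulA : associative tmul.
Proof.
move=> x y z.
apply: (tensor_ext (f := fun x => tmul x (tmul y z))
                   (g := fun x => tmul (tmul x y) z)) x => [||a b].
- exact: tmul_linearl.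
- exact: linear_comp2 (tmul_linearl _) (tmul_linearl _).
apply: (tensor_ext (f := fun y => tmul _ (tmul y z))
                   (g := fun y => tmul (tmul _ y) z)) y => [||a' b'].
- exact: linear_comp2 (tmul_linearl _) (tmul_linearr _).
- exact: linear_comp2 (tmul_linearr _) (tmul_linearl _).
apply: (tensor_ext (f := fun z => tmul _ (tmul _ z))
                   (g := fun z => tmul (tmul _ _) z)) z => [||a'' b''].
- exact: linear_comp2 (tmul_linearr _) (tmul_linearr _).
- exact: tmul_linearr.
by rewrite !tmul_pure !mulrA.
Qed.

Lemma tmul1 : left_id tone tmul.
Proof.
apply: tensor_ext => [||a b]; [exact: tmul_linearr|exact: linear_id2|].
by rewrite tmul_pure !mul1r.
Qed.

Lemma tmulr1 : right_id tone tmul.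
Proof.
apply: tensor_ext => [||a b]; [exact: tmul_linearl|exact: linear_id2|].
by rewrite tmul_pure !mulr1.
Qed.

Lemma tmulDl : left_distributive tmul +%R.
Proof. by move=> x y z; have := tmul_linearl z 1 x y; rewrite !scale1r. Qed.

Lemma tmulDr : right_distributive tmul +%R.
Proof. by move=> x y z; have := tmul_linearr x 1 y z; rewrite !scale1r. Qed.

Lemma tone_neq0 : tone != 0.
Proof.
have [f f1] := exists_functional (oner_neq0 A).
have [g g1] := exists_functional (oner_neq0 B).
have fgb : bilin (fun a b => f a * g b : K^o).
  split=> [b|a] c x y; rewrite linearP /= ?mulrDl ?mulrDr -?scalerAl //.
  by rewrite scalerAr.
have /eqP n0 : tlift (fun a b => f a * g b : K^o) tone != 0.
  by rewrite tlift_pure // f1 g1 mulr1 oner_neq0.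
apply/eqP => t0; apply: n0; rewrite t0.
have := tlift_linear fgb (-1) 0 0.
by rewrite scaler0 addr0 scaleN1r addNr.
Qed.

HB.instance Definition _ := GRing.Zmodule_isNzRing.Build (A ⊗ B)%type
  tmulA tmul1 tmulr1 tmulDl tmulDr tone_neq0.

Lemma tensor_mulE a b a' b' :
  (a ⊗ b) * (a' ⊗ b') = (a * a') ⊗ (b * b') :> A ⊗ B.
Proof. exact: tmul_pure. Qed.

Lemma tensor_scalerAl c (x y : A ⊗ B) : c *: (x * y) = (c *: x) * y.
Proof.
have := tmul_linearl y c x 0.
by rewrite addr0 -[tmul]/( *%R) mul0r addr0.
Qed.
HB.instance Definition _ :=
  GRing.Lmodule_isLalgebra.Build K (A ⊗ B)%type tensor_scalerAl.

Lemma tensor_scalerAr c (x y : A ⊗ B) : c *: (x * y) = x * (c *: y).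
Proof.
have := tmul_linearr x c y 0.
by rewrite addr0 -[tmul]/( *%R) mulr0 addr0.
Qed.
HB.instance Definition _ :=
  GRing.Lalgebra_isAlgebra.Build K (A ⊗ B)%type tensor_scalerAr.

End TensorAlgebra.

Inductive term (K X : Type) : Type :=
| Gen of X
| Cst of K
| Add of term K X & term K X
| Mul of term K X & term K X.
Arguments Gen {K X}.
Arguments Cst {K X}.

HB.instance Definition _ (K X : Type) := gen_eqMixin (term K X).
HB.instance Definition _ (K X : Type) := gen_choiceMixin (term K X).

Section Presentation.
Variables (K : fieldType) (X : Type) (R : term K X -> term K X -> Prop).

(* The congruence generated by R and the axioms of unital associative          *)
(* K-algebras, with Cst as structure map; thus pres below is the quotient of   *)
(* the free algebra K<X> by the two-sided ideal generated by the differences   *)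
(* of the pairs related by R. It may be the zero ring.                        *)
Inductive pres_eq : term K X -> term K X -> Prop :=
| pres_refl x : pres_eq x x
| pres_sym x y : pres_eq x y -> pres_eq y x
| pres_trans x y z : pres_eq x y -> pres_eq y z -> pres_eq x z
| pres_add x x' y y' :
    pres_eq x x' -> pres_eq y y' -> pres_eq (Add x y) (Add x' y')
| pres_mul x x' y y' :
    pres_eq x x' -> pres_eq y y' -> pres_eq (Mul x y) (Mul x' y')
| pres_addA x y z : pres_eq (Add x (Add y z)) (Add (Add x y) z)
| pres_addC x y : pres_eq (Add x y) (Add y x)
| pres_add0 x : pres_eq (Add (Cst 0) x) x
| pres_addN x : pres_eq (Add (Mul (Cst (-1)) x) x) (Cst 0)
| pres_mulA x y z : pres_eq (Mul x (Mul y z)) (Mul (Mul x y) z)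
| pres_mul1 x : pres_eq (Mul (Cst 1) x) x
| pres_mulDl x y z : pres_eq (Mul (Add x y) z) (Add (Mul x z) (Mul y z))
| pres_mulDr x y z : pres_eq (Mul x (Add y z)) (Add (Mul x y) (Mul x z))
| pres_cstD c d : pres_eq (Cst (c + d)) (Add (Cst c) (Cst d))
| pres_cstM c d : pres_eq (Cst (c * d)) (Mul (Cst c) (Cst d))
| pres_cstC c x : pres_eq (Mul (Cst c) x) (Mul x (Cst c))
| pres_rel x y : R x y -> pres_eq x y.

Definition pres_eqb (s t : term K X) : bool := `[< pres_eq s t >].

Lemma pres_eqb_refl : reflexive pres_eqb.
Proof. by move=> s; apply/asboolP/pres_refl. Qed.
Lemma pres_eqb_sym : symmetric pres_eqb.
Proof. by move=> s t; apply/asboolP/asboolP; apply: pres_sym. Qed.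
Lemma pres_eqb_trans : transitive pres_eqb.
Proof.
move=> t s u /asboolP st /asboolP tu; apply/asboolP.
exact: pres_trans st tu.
Qed.
Canonical pres_equiv :=
  EquivRel pres_eqb pres_eqb_refl pres_eqb_sym pres_eqb_trans.

Definition pres := {eq_quot pres_equiv}.
HB.instance Definition _ := Choice.on pres.
HB.instance Definition _ := EqQuotient.on pres.

Lemma pres_eqP s t : reflect (\pi_pres s = \pi_pres t) `[< pres_eq s t >].
Proof. exact: eqmodP. Qed.

Lemma pres_pi_eq s t : pres_eq s t -> \pi_pres s = \pi_pres t.
Proof. by move=> st; apply/pres_eqP/asboolP. Qed.

Lemma pres_repr s : pres_eq (repr (\pi_pres s)) s.
Proof. by apply/asboolP/pres_eqP; rewrite reprK. Qed.

Definition padd := lift_op2 pres (@Add K X).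
Definition pmul := lift_op2 pres (@Mul K X).
Definition pcst (c : K) : pres := \pi_pres (Cst c).
Definition pgen (x : X) : pres := \pi_pres (Gen x).
Definition popp (x : pres) : pres := pmul (pcst (-1)) x.
Definition pscale (c : K) (x : pres) : pres := pmul (pcst c) x.

Lemma pi_padd s t : \pi_pres (Add s t) = padd (\pi_pres s) (\pi_pres t).
Proof.
by unlock padd; apply/esym/pres_pi_eq/pres_add; apply: pres_repr.
Qed.
Lemma pi_pmul s t : \pi_pres (Mul s t) = pmul (\pi_pres s) (\pi_pres t).
Proof.
by unlock pmul; apply/esym/pres_pi_eq/pres_mul; apply: pres_repr.
Qed.

Lemma paddA : associative padd.
Proof.
elim/quotW=> x; elim/quotW=> y; elim/quotW=> z.
by rewrite -!pi_padd; apply/pres_pi_eq/pres_addA.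
Qed.
Lemma paddC : commutative padd.
Proof.
by elim/quotW=> x; elim/quotW=> y; rewrite -!pi_padd; apply/pres_pi_eq/pres_addC.
Qed.
Lemma padd0 : left_id (pcst 0) padd.
Proof.
by elim/quotW=> x; rewrite /pcst -pi_padd; apply/pres_pi_eq/pres_add0.
Qed.
Lemma paddN : left_inverse (pcst 0) popp padd.
Proof.
elim/quotW=> x; rewrite /popp /pcst -pi_pmul -pi_padd.
exact/pres_pi_eq/pres_addN.
Qed.
Lemma pmulA : associative pmul.
Proof.
elim/quotW=> x; elim/quotW=> y; elim/quotW=> z.
by rewrite -!pi_pmul; apply/pres_pi_eq/pres_mulA.
Qed.
Lemma pcst_comm c x : pmul (pcst c) x = pmul x (pcst c).
Proof.
elim/quotW: x => x; rewrite /pcst -!pi_pmul.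
exact/pres_pi_eq/pres_cstC.
Qed.
Lemma pmul1 : left_id (pcst 1) pmul.
Proof.
by elim/quotW=> x; rewrite /pcst -pi_pmul; apply/pres_pi_eq/pres_mul1.
Qed.
Lemma pmulr1 : right_id (pcst 1) pmul.
Proof. by move=> x; rewrite -pcst_comm pmul1. Qed.
Lemma pmulDl : left_distributive pmul padd.
Proof.
elim/quotW=> x; elim/quotW=> y; elim/quotW=> z.
by rewrite -!pi_padd -!pi_pmul -pi_padd; apply/pres_pi_eq/pres_mulDl.
Qed.
Lemma pmulDr : right_distributive pmul padd.
Proof.
elim/quotW=> x; elim/quotW=> y; elim/quotW=> z.
by rewrite -!pi_padd -!pi_pmul -pi_padd; apply/pres_pi_eq/pres_mulDr.
Qed.
Lemma pcstD c d : pcst (c + d) = padd (pcst c) (pcst d).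
Proof. by rewrite /pcst -pi_padd; apply/pres_pi_eq/pres_cstD. Qed.
Lemma pcstM c d : pcst (c * d) = pmul (pcst c) (pcst d).
Proof. by rewrite /pcst -pi_pmul; apply/pres_pi_eq/pres_cstM. Qed.

HB.instance Definition _ :=
  GRing.isZmodule.Build pres paddA paddC padd0 paddN.
HB.instance Definition _ :=
  GRing.Zmodule_isPzRing.Build pres pmulA pmul1 pmulr1 pmulDl pmulDr.

Lemma pscaleA a b x : pscale a (pscale b x) = pscale (a * b) x.
Proof. by rewrite /pscale pcstM pmulA. Qed.
Lemma pscale1 : left_id 1 pscale. Proof. exact: pmul1. Qed.
Lemma pscaleDr : right_distributive pscale +%R.
Proof. by move=> c x y; apply: pmulDr. Qed.
Lemma pscaleDl x : {morph pscale^~ x : a b / a + b}.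
Proof. by move=> a b; rewrite /pscale pcstD; apply: pmulDl. Qed.
HB.instance Definition _ :=
  GRing.Zmodule_isLmodule.Build K pres pscaleA pscale1 pscaleDr pscaleDl.

Lemma pres_scalerAl c (x y : pres) : c *: (x * y) = (c *: x) * y.
Proof. exact: pmulA. Qed.
Lemma pres_scalerAr c (x y : pres) : c *: (x * y) = x * (c *: y).
Proof.
rewrite [LHS]pmulA [X in pmul X _ = _]pcst_comm.
by rewrite [RHS]pmulA.
Qed.

Lemma piD s t : \pi_pres (Add s t) = \pi_pres s + \pi_pres t.
Proof. exact: pi_padd. Qed.
Lemma piM s t : \pi_pres (Mul s t) = \pi_pres s * \pi_pres t.
Proof. exact: pi_pmul. Qed.
Lemma piC c : \pi_pres (Cst c) = c *: (1 : pres).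
Proof. by rewrite /GRing.scale /= /pscale -[LHS]pmulr1. Qed.

Section Lift.
Variables (B : algType K) (f : X -> B).

Fixpoint term_eval (t : term K X) : B :=
  match t with
  | Gen x => f x
  | Cst c => c%:A
  | Add s t => term_eval s + term_eval t
  | Mul s t => term_eval s * term_eval t
  end.

Definition pres_lift (x : pres) : B := term_eval (repr x).

Hypothesis fR : forall s t, R s t -> term_eval s = term_eval t.

Lemma term_eval_eq s t : pres_eq s t -> term_eval s = term_eval t.
Proof.
elim=> {s t} //=.
- by move=> x y z _ -> _ ->.
- by move=> x x' y y' _ -> _ ->.
- by move=> x x' y y' _ -> _ ->.
- by move=> x y z; rewrite addrA.
- by move=> x y; rewrite addrC.
- by move=> x; rewrite scale0r add0r.
- by move=> x; rewrite scaleN1r mulN1r scale0r addNr.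
- by move=> x y z; rewrite mulrA.
- by move=> x; rewrite scale1r mul1r.
- by move=> x y z; rewrite mulrDl.
- by move=> x y z; rewrite mulrDr.
- by move=> c d; rewrite scalerDl.
- by move=> c d; rewrite -scalerAl mul1r scalerA.
- by move=> c x; rewrite -scalerAl -scalerAr mul1r mulr1.
Qed.

Lemma pres_lift_pi s : pres_lift (\pi_pres s) = term_eval s.
Proof. exact/term_eval_eq/pres_repr. Qed.
Lemma pres_lift_gen x : pres_lift (pgen x) = f x.
Proof. exact: pres_lift_pi. Qed.
Lemma pres_lift1 : pres_lift 1 = 1.
Proof. by rewrite [LHS]pres_lift_pi /= scale1r. Qed.
Lemma pres_liftM : {morph pres_lift : x y / x * y}.
Proof.
by elim/quotW=> x; elim/quotW=> y; rewrite -piM !pres_lift_pi.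
Qed.
Lemma pres_lift_linear : linear pres_lift.
Proof.
move=> c; elim/quotW=> x; elim/quotW=> y.
have -> : c *: \pi_pres x + \pi_pres y = \pi_pres (Add (Mul (Cst c) x) y).
  by rewrite piD piM piC -pres_scalerAl mul1r.
by rewrite !pres_lift_pi /= -scalerAl mul1r.
Qed.

Lemma pres_neq0 : 1 != 0 :> pres.
Proof.
apply/eqP => /(congr1 pres_lift); rewrite pres_lift1.
rewrite [RHS]pres_lift_pi /= scale0r => /eqP.
by rewrite oner_eq0.
Qed.

End Lift.

Lemma pres_ind (P : pres -> Prop) :
    (forall x, P (pgen x)) -> (forall c, P (c *: (1 : pres))) ->
    (forall x y, P x -> P y -> P (x + y)) ->
    (forall x y, P x -> P y -> P (x * y)) ->
  forall x, P x.
Proof.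
move=> Pg Pc Pa Pm; elim/quotW; elim=> [x|c|s Ps t Pt|s Ps t Pt].
- exact: Pg.
- by rewrite piC; apply: Pc.
- by rewrite piD; apply: Pa.
- by rewrite piM; apply: Pm.
Qed.

End Presentation.

Section QuantumTriangular.
Variables (K : fieldType) (n : nat) (q : K).

(* The index set of the generators a_ij, i <= j, numbered from 0.              *)
Definition Tq_index := {ij : 'I_n * 'I_n | (ij.1 <= ij.2)%N}.

Local Notation tm := (term K Tq_index).

Definition Tq_var (i j : 'I_n) (le_ij : (i <= j)%N) : tm :=
  Gen (exist (fun ij : 'I_n * 'I_n => (ij.1 <= ij.2)%N) (i, j) le_ij).

Inductive Tq_rel : tm -> tm -> Prop :=
| Tq_rel_col (i j k : 'I_n) (ik : (i <= k)%N) (jk : (j <= k)%N) :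
    (i < j)%N ->
    Tq_rel (Mul (Tq_var jk) (Tq_var ik))
           (Mul (Cst q) (Mul (Tq_var ik) (Tq_var jk)))
| Tq_rel_row (j k l : 'I_n) (jk : (j <= k)%N) (jl : (j <= l)%N) :
    (k < l)%N ->
    Tq_rel (Mul (Tq_var jk) (Tq_var jl))
           (Mul (Cst q) (Mul (Tq_var jl) (Tq_var jk)))
| Tq_rel_comm (i j k l : 'I_n) (ik : (i <= k)%N) (jl : (j <= l)%N) :
    (i < j)%N -> (k < l)%N ->
    Tq_rel (Mul (Tq_var ik) (Tq_var jl)) (Mul (Tq_var jl) (Tq_var ik))
| Tq_rel_cross (i j k l : 'I_n) (jk : (j <= k)%N) (il : (i <= l)%N) :
    (i < j)%N -> (k < l)%N ->
    Tq_rel (Mul (Tq_var jk) (Tq_var il))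
           (Mul (Cst (q ^+ 2)) (Mul (Tq_var il) (Tq_var jk))).

Definition Tq := pres Tq_rel.

HB.instance Definition _ := Choice.on Tq.
HB.instance Definition _ := GRing.PzRing.on Tq.
HB.instance Definition _ := GRing.Lmodule.on Tq.

Definition Tq_counit_gen (x : Tq_index) : K^o := ((val x).1 == (val x).2)%:R.

Lemma Tq_counit_rel s t :
  Tq_rel s t -> term_eval Tq_counit_gen s = term_eval Tq_counit_gen t.
Proof.
case=> {s t} [i j k ik jk ij|j k l jk jl kl|i j k l ik jl ij kl|i j k l jk il ij kl];
  rewrite /= /Tq_counit_gen /=.
- by rewrite (negPf (_ : i != k)) ?mulr0 ?mul0r ?mulr0 // -val_eqE neq_ltn (leq_trans ij jk).
- by rewrite (negPf (_ : j != l)) ?mulr0 ?mul0r ?mulr0 // -val_eqE neq_ltn (leq_ltn_trans jk kl).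
- by rewrite mulrC.
- rewrite (negPf (_ : i != l)) ?mulr0 ?mul0r ?mulr0 // -val_eqE neq_ltn.
  by rewrite (leq_ltn_trans (leq_trans (ltnW ij) jk) kl).
Qed.

Lemma Tq_neq0 : 1 != 0 :> Tq.
Proof. exact: pres_neq0 Tq_counit_rel. Qed.

HB.instance Definition _ := GRing.PzSemiRing_isNonZero.Build Tq Tq_neq0.
HB.instance Definition _ :=
  GRing.Lmodule_isLalgebra.Build K Tq (@pres_scalerAl _ _ _).
HB.instance Definition _ :=
  GRing.Lalgebra_isAlgebra.Build K Tq (@pres_scalerAr _ _ _).

(* The generator a_ij for i <= j, extended by a_ij = 0 for i > j.             *)
Definition Tq_gen (i j : 'I_n) : Tq :=
  if insub (i, j) is Some x then pgen Tq_rel x else 0.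

Definition Tq_det : Tq := \prod_(i < n) Tq_gen i i.

End QuantumTriangular.

Section TensorMorphisms.
Variable K : fieldType.

Lemma tlift_monoid (A B C : algType K) (h : A -> B -> C) :
    bilin h -> h 1 1 = 1 ->
    (forall a a' b b', h (a * a') (b * b') = h a b * h a' b') ->
  monoid_morphism (tlift h).
Proof.
move=> hb h1 hM; split=> [|x y]; first by rewrite tlift_pure.
have hl := tlift_linear hb.
have ml (z : C) : linear (fun w : C => w * z).
  by move=> c u v; rewrite mulrDl scalerAl.
have mr (z : C) : linear (fun w : C => z * w).
  by move=> c u v; rewrite mulrDr scalerAr.
apply: (tensor_ext (f := fun x => tlift h (x * y))
                   (g := fun x => tlift h x * tlift h y)) x => [||a b].
- exact: linear_comp2 (tmul_linearl y) hl.
- exact: linear_comp2 hl (ml _).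
apply: (tensor_ext (f := fun y => tlift h (_ * y))
                   (g := fun y => _ * tlift h y)) y => [||a' b'].
- exact: linear_comp2 (tmul_linearr _) hl.
- exact: linear_comp2 hl (mr _).
by rewrite tensor_mulE !tlift_pure.
Qed.

Section Map.
Variables (V V' W W' : lmodType K) (f : {linear V -> V'}) (g : {linear W -> W'}).
HB.instance Definition _ := GRing.isLinear.Build K (V ⊗ W)%type (V' ⊗ W')%type
  *:%R (tensor_map f g) (tensor_map_linear (linearP f) (linearP g)).
End Map.

HB.instance Definition _ (U V W : lmodType K) :=
  GRing.isLinear.Build K ((U ⊗ V) ⊗ W)%type (U ⊗ (V ⊗ W))%type
  *:%R (@tensor_assoc K U V W) (@tensor_assoc_linear K U V W).

Section MapAlg.
Variables (A A' B B' : algType K).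
Variables (f : {lrmorphism A -> A'}) (g : {lrmorphism B -> B'}).
Lemma tensor_map_monoid : monoid_morphism (tensor_map f g : A ⊗ B -> A' ⊗ B').
Proof.
apply: tlift_monoid; first exact/tensor_map_bilin/linearP/linearP.
  by rewrite !rmorph1.
by move=> a a' b b'; rewrite !rmorphM tensor_mulE.
Qed.
HB.instance Definition _ := GRing.isMonoidMorphism.Build (A ⊗ B)%type
  (A' ⊗ B')%type (tensor_map f g) tensor_map_monoid.
End MapAlg.

Lemma tensor_assoc_monoid (A B C : algType K) :
  monoid_morphism (@tensor_assoc K A B C).
Proof.
apply: tlift_monoid; first exact: tensor_assoc_bilin.
  by rewrite tlift_pure //; apply: tensor_assoc_bilin0.
move=> x x' c c'.
have l0 (w : C) := tlift_linear (@tensor_assoc_bilin0 K A B C w).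
apply: (tensor_ext (f := fun x => tlift _ (x * _))
                   (g := fun x => tlift _ x * _)) x => [||a b].
- exact: linear_comp2 (tmul_linearl _) (l0 _).
- exact: linear_comp2 (l0 _) (tmul_linearl _).
apply: (tensor_ext (f := fun x => tlift _ (_ * x))
                   (g := fun x => _ * tlift _ x)) x' => [||a' b'].
- exact: linear_comp2 (tmul_linearr _) (l0 _).
- exact: linear_comp2 (l0 _) (tmul_linearr _).
rewrite tensor_mulE !tlift_pure ?tensor_mulE //; exact: tensor_assoc_bilin0.
Qed.
HB.instance Definition _ (A B C : algType K) :=
  GRing.isMonoidMorphism.Build ((A ⊗ B) ⊗ C)%type (A ⊗ (B ⊗ C))%type
  (@tensor_assoc K A B C) (@tensor_assoc_monoid A B C).

End TensorMorphisms.

Section Bialgebra.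
Variables (K : fieldType) (A : algType K).

Record bialgebra := Bialgebra {
  comul : {lrmorphism A -> A ⊗ A};
  counit : {lrmorphism A -> K^o};
  comulA : forall x : A,
    tensor_assoc (tensor_map comul idfun (comul x))
    = tensor_map idfun comul (comul x);
  counitl : forall x : A, tlift (fun a b => counit a *: b) (comul x) = x;
  counitr : forall x : A, tlift (fun a b => counit b *: a) (comul x) = x
}.

Definition is_antipode (H : bialgebra) (S : A -> A) : Prop :=
  forall x : A,
    tlift (fun a b => S a * b) (comul H x) = (counit H x)%:A /\
    tlift (fun a b => a * S b) (comul H x) = (counit H x)%:A.

Definition is_hopf (H : bialgebra) : Prop :=
  exists S : {linear A -> A}, is_antipode H S.

End Bialgebra.

Section Localization.
Variables (K : fieldType) (A : algType K) (s : A).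

(* Some a is the image of a : A, and None is the inverse of the image of s.    *)
Inductive loc_rel : term K (option A) -> term K (option A) -> Prop :=
| loc_add a b : loc_rel (Gen (Some (a + b))) (Add (Gen (Some a)) (Gen (Some b)))
| loc_mul a b : loc_rel (Gen (Some (a * b))) (Mul (Gen (Some a)) (Gen (Some b)))
| loc_cst c : loc_rel (Gen (Some c%:A)) (Cst c)
| loc_mulV : loc_rel (Mul (Gen (Some s)) (Gen None)) (Cst 1)
| loc_mulVr : loc_rel (Mul (Gen None) (Gen (Some s))) (Cst 1).

(* The localization A[s^-1] at the powers of s: the universal algebra under A  *)
(* in which s is invertible. For s normal (s A = A s), as det_q(n) is in        *)
(* T_q(n), this is the Ore localization.                                      *)
Definition loc := pres loc_rel.
HB.instance Definition _ := Choice.on loc.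
HB.instance Definition _ := GRing.PzRing.on loc.
HB.instance Definition _ := GRing.Lmodule.on loc.

Definition loc_emb (a : A) : loc := pgen loc_rel (Some a).
Definition loc_inv : loc := pgen loc_rel None.

Lemma loc_embD : {morph loc_emb : a b / a + b}.
Proof. by move=> a b; rewrite [RHS]/GRing.add /= -pi_padd; apply/pres_pi_eq/pres_rel/loc_add. Qed.
Lemma loc_embM : {morph loc_emb : a b / a * b}.
Proof. by move=> a b; rewrite [RHS]/GRing.mul /= -pi_pmul; apply/pres_pi_eq/pres_rel/loc_mul. Qed.
Lemma loc_emb_cst c : loc_emb c%:A = c *: (1 : loc).
Proof.
rewrite [LHS](pres_pi_eq (pres_rel (loc_cst c))).
exact: piC.
Qed.
Lemma loc_emb1 : loc_emb 1 = 1.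
Proof. by rewrite -[1 in LHS]scale1r loc_emb_cst scale1r. Qed.
Lemma loc_embP : linear loc_emb.
Proof.
move=> c a b; rewrite -[a in LHS]mul1r scalerAl loc_embD loc_embM loc_emb_cst.
by rewrite -(@pres_scalerAl K _ loc_rel c 1) mul1r.
Qed.
Lemma loc_mulrV : loc_emb s * loc_inv = 1.
Proof.
rewrite [LHS]/GRing.mul /= -pi_pmul (pres_pi_eq (pres_rel loc_mulV)).
by rewrite piC scale1r.
Qed.
Lemma loc_mulVl : loc_inv * loc_emb s = 1.
Proof.
rewrite [LHS]/GRing.mul /= -pi_pmul (pres_pi_eq (pres_rel loc_mulVr)).
by rewrite piC scale1r.
Qed.

HB.instance Definition _ := GRing.isLinear.Build K A loc *:%R loc_emb loc_embP.
HB.instance Definition _ :=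
  GRing.isMonoidMorphism.Build A loc loc_emb (loc_emb1, loc_embM).

Section Lift.
Variables (B : algType K) (f : A -> B) (u : B).
Hypotheses (fP : linear f) (fM : monoid_morphism f).
Hypotheses (fsu : f s * u = 1) (ufs : u * f s = 1).

Definition loc_lift_gen (x : option A) : B := if x is Some a then f a else u.

Lemma loc_lift_rel t t' :
  loc_rel t t' -> term_eval loc_lift_gen t = term_eval loc_lift_gen t'.
Proof.
case=> [a b|a b|c||] /=; rewrite ?scale1r //.
- by have := fP 1 a b; rewrite !scale1r.
- exact: fM.2.
- have f0 : f 0 = 0.
    by have := fP (-1) 0 0; rewrite !scaleN1r !addNr.
  by have := fP c 1 0; rewrite !addr0 f0 addr0 fM.1.
Qed.

End Lift.
End Localization.

Section QuantumTriangularTheory.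
Variables (K : fieldType) (n : nat) (q : K).
Local Notation a := (@Tq_gen K n q).

Lemma Tq_gen_index (x : Tq_index n) :
  a (val x).1 (val x).2 = pgen (@Tq_rel K n q) x.
Proof.
by case: x => [[i j] ij] /=; rewrite /Tq_gen insubT.
Qed.

Lemma Tq_genE (i j : 'I_n) (ij : (i <= j)%N) :
  a i j = pgen (@Tq_rel K n q)
    (exist (fun ij : 'I_n * 'I_n => (ij.1 <= ij.2)%N) (i, j) ij).
Proof. by rewrite -Tq_gen_index. Qed.

Lemma Tq_gen0 (i j : 'I_n) : (j < i)%N -> a i j = 0.
Proof. by move=> ji; rewrite /Tq_gen insubF //= leqNgt ji. Qed.

Lemma Tq_relE c (x y z w : Tq_index n) :
    Tq_rel q (Mul (Gen x) (Gen y)) (Mul (Cst c) (Mul (Gen z) (Gen w))) ->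
  pgen (@Tq_rel K n q) x * pgen (@Tq_rel K n q) y
  = c *: (pgen (@Tq_rel K n q) z * pgen (@Tq_rel K n q) w).
Proof.
by move=> /(@pres_rel _ _ _)/pres_pi_eq; rewrite !piM piC -pres_scalerAl mul1r.
Qed.

Lemma Tq_row (j k l : 'I_n) : (k < l)%N ->
  a j k * a j l = q *: (a j l * a j k).
Proof.
move=> kl; have [jk|kj] := leqP j k; last first.
  by rewrite (Tq_gen0 kj) mul0r mulr0 scaler0.
have jl := leq_trans jk (ltnW kl).
by rewrite (Tq_genE jk) (Tq_genE jl); apply/Tq_relE/Tq_rel_row.
Qed.

Lemma Tq_col (i j k : 'I_n) : (i < j)%N ->
  a j k * a i k = q *: (a i k * a j k).
Proof.
move=> ij; have [jk|kj] := leqP j k; last first.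
  by rewrite (Tq_gen0 kj) mul0r mulr0 scaler0.
have ik := leq_trans (ltnW ij) jk.
by rewrite (Tq_genE jk) (Tq_genE ik); apply/Tq_relE/Tq_rel_col.
Qed.

Lemma Tq_comm (i j k l : 'I_n) : (i < j)%N -> (k < l)%N ->
  a i k * a j l = a j l * a i k.
Proof.
move=> ij kl; have [ik|ki] := leqP i k; last first.
  by rewrite (Tq_gen0 ki) mul0r mulr0.
have [jl|lj] := leqP j l; last first.
  by rewrite (Tq_gen0 lj) mul0r mulr0.
rewrite (Tq_genE ik) (Tq_genE jl).
have := pres_pi_eq (pres_rel (Tq_rel_comm q ik jl ij kl)).
by rewrite !piM.
Qed.

Lemma Tq_cross (i j k l : 'I_n) : (i < j)%N -> (k < l)%N ->
  a j k * a i l = q ^+ 2 *: (a i l * a j k).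
Proof.
move=> ij kl; have [jk|kj] := leqP j k; last first.
  by rewrite (Tq_gen0 kj) mul0r mulr0 scaler0.
have il : (i <= l)%N := leq_trans (leq_trans (ltnW ij) jk) (ltnW kl).
by rewrite (Tq_genE jk) (Tq_genE il); apply/Tq_relE/Tq_rel_cross.
Qed.

(* By the relations and the convention a_ij = 0 for i > j, for all i, j, k, l   *)
(* a_jk a_il = q^(sgn(j - i) + sgn(l - k)) a_il a_jk.                          *)
Definition tw (i j : nat) : K :=
  if (i < j)%N then q else if (j < i)%N then q^-1 else 1.

Hypothesis q_neq0 : q != 0.

Lemma tw_inv i j : tw i j * tw j i = 1.
Proof. by rewrite /tw; case: ltngtP; rewrite ?mulr1 ?mulfV ?mulVf. Qed.

Lemma Tq_tw (i j k l : 'I_n) :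
  a j k * a i l = (tw i j * tw k l) *: (a i l * a j k).
Proof.
have W (i' j' k' l' : 'I_n) :
    a i' l' * a j' k' = (tw j' i' * tw l' k') *: (a j' k' * a i' l') ->
    a j' k' * a i' l' = (tw i' j' * tw k' l') *: (a i' l' * a j' k').
  by move=> ->; rewrite scalerA mulrACA !tw_inv mulr1 scale1r.
case: (ltngtP i j) => [ij|ij|/val_inj ij].
- rewrite [tw i j]/tw ij; have [kl|lk|/val_inj ->] := ltngtP k l.
  + by rewrite /tw kl -expr2; apply: Tq_cross.
  + by rewrite /tw ltnNge ltnW //= lk mulfV // scale1r; apply/esym/Tq_comm.
  + by rewrite /tw ltnn mulr1; apply: Tq_col.
- have [kl|lk|/val_inj ->] := ltngtP k l.
  + by rewrite /tw kl ltnNge ltnW //= ij mulVf // scale1r; apply/Tq_comm.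
  + by apply: W; rewrite /tw ij lk -expr2; apply: Tq_cross.
  + by apply: W; rewrite /tw ij ltnn mulr1; apply: Tq_col.
- rewrite {}ij; have [kl|lk|/val_inj ->] := ltngtP k l.
  + by rewrite /tw ltnn kl mul1r; apply: Tq_row.
  + by apply: W; rewrite /tw ltnn lk mul1r; apply: Tq_row.
  + by rewrite /tw !ltnn mulr1 scale1r.
Qed.

End QuantumTriangularTheory.

Section UT.
Variables (K : fieldType) (n : nat) (q : K).

Definition UTq := loc (Tq_det n q).
HB.instance Definition _ := Choice.on UTq.
HB.instance Definition _ := GRing.PzRing.on UTq.
HB.instance Definition _ := GRing.Lmodule.on UTq.

Definition Tq_counit : Tq n q -> K^o := pres_lift (@Tq_counit_gen K n).

Lemma Tq_counit_linear : linear Tq_counit.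
Proof. exact/pres_lift_linear/Tq_counit_rel. Qed.
Lemma Tq_counit_monoid : monoid_morphism Tq_counit.
Proof.
split; first exact/pres_lift1/Tq_counit_rel.
exact/pres_liftM/Tq_counit_rel.
Qed.
HB.instance Definition _ := GRing.isLinear.Build K (Tq n q) K^o *%R
  Tq_counit Tq_counit_linear.
HB.instance Definition _ := GRing.isMonoidMorphism.Build (Tq n q) K^o
  Tq_counit Tq_counit_monoid.

Lemma Tq_counitE i j : Tq_counit (Tq_gen q i j) = (i == j)%:R.
Proof.
have [ij|ji] := leqP i j.
  by rewrite Tq_genE [LHS]pres_lift_gen //; apply: Tq_counit_rel.
by rewrite Tq_gen0 // raddf0 -val_eqE gtn_eqF.
Qed.

Lemma Tq_counit_det : Tq_counit (Tq_det n q) = 1.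
Proof. by rewrite rmorph_prod big1 // => i _; rewrite [LHS]Tq_counitE eqxx. Qed.

Definition UTq_counit : UTq -> K^o := pres_lift (loc_lift_gen Tq_counit 1).

Lemma UTq_counit_rel s t : loc_rel (Tq_det n q) s t ->
  term_eval (loc_lift_gen Tq_counit 1) s = term_eval (loc_lift_gen Tq_counit 1) t.
Proof.
apply: loc_lift_rel; rewrite ?Tq_counit_det ?mulr1 //.
  exact: Tq_counit_linear.
exact: Tq_counit_monoid.
Qed.

Lemma UTq_neq0 : 1 != 0 :> UTq.
Proof. exact: pres_neq0 UTq_counit_rel. Qed.

HB.instance Definition _ := GRing.PzSemiRing_isNonZero.Build UTq UTq_neq0.
HB.instance Definition _ :=
  GRing.Lmodule_isLalgebra.Build K UTq (@pres_scalerAl _ _ _).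
HB.instance Definition _ :=
  GRing.Lalgebra_isAlgebra.Build K UTq (@pres_scalerAr _ _ _).

Lemma UTq_counit_linear : linear UTq_counit.
Proof. exact/pres_lift_linear/UTq_counit_rel. Qed.
Lemma UTq_counit_monoid : monoid_morphism UTq_counit.
Proof.
split; first exact/pres_lift1/UTq_counit_rel.
exact/pres_liftM/UTq_counit_rel.
Qed.
HB.instance Definition _ := GRing.isLinear.Build K UTq K^o *%R
  UTq_counit UTq_counit_linear.
HB.instance Definition _ := GRing.isMonoidMorphism.Build UTq K^o
  UTq_counit UTq_counit_monoid.

Definition UTq_emb : Tq n q -> UTq := @loc_emb _ _ (Tq_det n q).
HB.instance Definition _ := GRing.isLinear.Build K (Tq n q) UTq *:%R
  UTq_emb (@loc_embP _ _ _).
HB.instance Definition _ := GRing.isMonoidMorphism.Build (Tq n q) UTq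
  UTq_emb (loc_emb1 _, @loc_embM _ _ _).

(* a_ij in UT_q(n), with a_ij = 0 for i > j.                                  *)
Definition UTq_gen (i j : 'I_n) : UTq := UTq_emb (Tq_gen q i j).
Definition UTq_det : UTq := UTq_emb (Tq_det n q).
Definition UTq_detV : UTq := loc_inv (Tq_det n q).

Lemma UTq_detE : UTq_det = \prod_(i < n) UTq_gen i i.
Proof. exact: rmorph_prod. Qed.
Lemma UTq_detK : UTq_det * UTq_detV = 1. Proof. exact: loc_mulrV. Qed.
Lemma UTq_detVK : UTq_detV * UTq_det = 1. Proof. exact: loc_mulVl. Qed.

Lemma UTq_counit_emb x : UTq_counit (UTq_emb x) = Tq_counit x.
Proof. by rewrite [LHS]pres_lift_gen //; apply: UTq_counit_rel. Qed.
Lemma UTq_counitE i j : UTq_counit (UTq_gen i j) = (i == j)%:R.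
Proof. by rewrite UTq_counit_emb Tq_counitE. Qed.
Lemma UTq_counit_detV : UTq_counit UTq_detV = 1.
Proof. by rewrite [LHS]pres_lift_gen //; apply: UTq_counit_rel. Qed.

Local Notation a := UTq_gen.

Lemma UTq_gen0 (i j : 'I_n) : (j < i)%N -> a i j = 0.
Proof. by move=> ji; rewrite /UTq_gen Tq_gen0 // raddf0. Qed.

Lemma Tq_ind (P : Tq n q -> Prop) :
    (forall i j, P (Tq_gen q i j)) -> (forall c, P c%:A) ->
    (forall x y, P x -> P y -> P (x + y)) ->
    (forall x y, P x -> P y -> P (x * y)) ->
  forall x, P x.
Proof.
move=> Pg Pc Pa Pm; apply: pres_ind => [x|||] //.
by rewrite -Tq_gen_index; apply: Pg.
Qed.

Lemma UTq_ind (P : UTq -> Prop) :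
    (forall i j, P (a i j)) -> P UTq_detV -> (forall c, P c%:A) ->
    (forall x y, P x -> P y -> P (x + y)) ->
    (forall x y, P x -> P y -> P (x * y)) ->
  forall x, P x.
Proof.
move=> Pg PV Pc Pa Pm.
have Pe x : P (UTq_emb x).
  move: x; apply: Tq_ind => [i j|c|x y Px Py|x y Px Py].
  - exact: Pg.
  - by rewrite linearZ rmorph1; apply: Pc.
  - by rewrite rmorphD; apply: Pa.
  - by rewrite rmorphM; apply: Pm.
by apply: pres_ind => [[x|]|||] //; apply: Pe.
Qed.

Lemma UTq_ext (B : algType K) (f g : {lrmorphism UTq -> B}) :
  (forall i j, f (a i j) = g (a i j)) -> f UTq_detV = g UTq_detV -> f =1 g.
Proof.
move=> fg fgV; apply: UTq_ind => [//|//|c|x y fgx fgy|x y fgx fgy].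
- by rewrite !linearZ /= !rmorph1.
- by rewrite !rmorphD; congr (_ + _).
- by rewrite !rmorphM; congr (_ * _).
Qed.

Local Notation b := (Tq_gen q).

Definition Tq_comul_gen (x : Tq_index n) : Tq n q ⊗ Tq n q :=
  \sum_(k < n | ((val x).1 <= k <= (val x).2)%N)
    (b (val x).1 k ⊗ b k (val x).2)%R.
Definition Tq_comul : Tq n q -> Tq n q ⊗ Tq n q := pres_lift Tq_comul_gen.

(* The comultiplication of T_q(n) followed by T_q(n)⊗T_q(n) -> UT_q(n)⊗UT_q(n),  *)
(* extended to UT_q(n) by det^-1 |-> det^-1 ⊗ det^-1.                          *)
Definition UTq_comul : UTq -> UTq ⊗ UTq :=
  pres_lift (loc_lift_gen (tensor_map UTq_emb UTq_emb \o Tq_comul)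
                          (UTq_detV ⊗ UTq_detV)).

Definition cogen (i j : 'I_n) : Tq n q ⊗ Tq n q :=
  \sum_(k < n) (b i k ⊗ b k j)%R.

Lemma cogen_cond (i j : 'I_n) :
  \sum_(k < n | (i <= k <= j)%N) (b i k ⊗ b k j)%R = cogen i j.
Proof.
rewrite big_mkcond; apply: eq_bigr => k _.
case: leqP => [_|ki]; last by rewrite Tq_gen0 ?pure0l.
by case: leqP => //= jk; rewrite (Tq_gen0 _ jk) pure0r.
Qed.

Lemma Tq_comul_genE (i j : 'I_n) (ij : (i <= j)%N) :
  Tq_comul_gen (exist (fun ij : 'I_n * 'I_n => (ij.1 <= ij.2)%N) (i, j) ij)
  = cogen i j.
Proof. exact: cogen_cond. Qed.

Hypothesis q_neq0 : q != 0.

Lemma cogen_tw (i j k l : 'I_n) :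
  cogen j k * cogen i l = (tw q i j * tw q k l) *: (cogen i l * cogen j k).
Proof.
rewrite /cogen !mulr_suml scaler_sumr.
under eq_bigr do rewrite mulr_sumr.
under [RHS]eq_bigr do rewrite mulr_sumr scaler_sumr.
rewrite exchange_big; apply: eq_bigr => s _; apply: eq_bigr => t _.
rewrite !tensor_mulE Tq_tw // (Tq_tw q_neq0 s t) pureZl pureZr scalerA; congr (_ *: _).
by rewrite mulrA mulrAC -!mulrA; congr (_ * _); rewrite mulrCA tw_inv // mulr1.
Qed.

Lemma Tq_comul_rel s t :
  Tq_rel q s t -> term_eval Tq_comul_gen s = term_eval Tq_comul_gen t.
Proof.
case=> {s t} [i j k ik jk ij|j k l jk jl kl|i j k l ik jl ij kl|i j k l jk il ij kl];
  rewrite /= !Tq_comul_genE cogen_tw -?scalerAl ?mul1r /tw ?ltnn ?ij ?kl.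
- by rewrite mulr1.
- by rewrite mul1r.
- by rewrite ltnNge ltnW //= mulVf // scale1r.
- by rewrite expr2.
Qed.

Lemma Tq_comul_linear : linear Tq_comul.
Proof. exact/pres_lift_linear/Tq_comul_rel. Qed.
Lemma Tq_comul_monoid : monoid_morphism Tq_comul.
Proof.
split; first exact/pres_lift1/Tq_comul_rel.
exact/pres_liftM/Tq_comul_rel.
Qed.

Lemma Tq_comulE (i j : 'I_n) : Tq_comul (Tq_gen q i j) = cogen i j.
Proof.
have [ij|ji] := leqP i j.
  rewrite Tq_genE [LHS]pres_lift_gen; first exact: Tq_comul_genE.
  exact: Tq_comul_rel.
rewrite Tq_gen0 // -cogen_cond big1 => [|k /andP[ik kj]].
  by have := Tq_comul_linear (-1) 0 0; rewrite !scaleN1r !addNr.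
by have := leq_trans ik kj; rewrite leqNgt ji.
Qed.

Lemma cogen_diag i : cogen i i = b i i ⊗ b i i.
Proof.
rewrite -cogen_cond (big_pred1 i) // => k /=.
by rewrite -eqn_leq eq_sym.
Qed.

Lemma Tq_comul_det : Tq_comul (Tq_det n q) = Tq_det n q ⊗ Tq_det n q.
Proof.
rewrite /Tq_det (big_morph _ Tq_comul_monoid.2 Tq_comul_monoid.1).
rewrite (big_morph (fun x : Tq n q => (x ⊗ x : Tq n q ⊗ Tq n q))
  (fun x y => esym (tensor_mulE x x y y)) erefl).
by apply: eq_bigr => i _; rewrite Tq_comulE cogen_diag.
Qed.

Lemma UTq_comul_rel s t : loc_rel (Tq_det n q) s t ->
  term_eval (loc_lift_gen (tensor_map UTq_emb UTq_emb \o Tq_comul)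
               (UTq_detV ⊗ UTq_detV)) s
  = term_eval (loc_lift_gen (tensor_map UTq_emb UTq_emb \o Tq_comul)
                 (UTq_detV ⊗ UTq_detV)) t.
Proof.
have dE : (tensor_map UTq_emb UTq_emb \o Tq_comul) (Tq_det n q)
        = UTq_det ⊗ UTq_det.
  by rewrite /comp Tq_comul_det; apply: tensor_map_pure.
apply: loc_lift_rel.
- exact: linear_comp2 Tq_comul_linear (linearP _).
- split=> [|x y]; rewrite /comp.
    by rewrite Tq_comul_monoid.1; apply: rmorph1.
  by rewrite Tq_comul_monoid.2; apply: rmorphM.
- by rewrite dE tensor_mulE UTq_detK.
- by rewrite dE tensor_mulE UTq_detVK.
Qed.

Lemma UTq_comul_linear : linear UTq_comul.
Proof. exact/pres_lift_linear/UTq_comul_rel. Qed.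
Lemma UTq_comul_monoid : monoid_morphism UTq_comul.
Proof.
split; first exact/pres_lift1/UTq_comul_rel.
exact/pres_liftM/UTq_comul_rel.
Qed.

Definition UTq_comul_lr : {lrmorphism UTq -> UTq ⊗ UTq} :=
  HB.pack UTq_comul
    (GRing.isLinear.Build K UTq (UTq ⊗ UTq)%type *:%R UTq_comul UTq_comul_linear)
    (GRing.isMonoidMorphism.Build UTq (UTq ⊗ UTq)%type UTq_comul
       UTq_comul_monoid).

Lemma UTq_comul_emb x :
  UTq_comul (UTq_emb x) = tensor_map UTq_emb UTq_emb (Tq_comul x).
Proof. by rewrite [LHS]pres_lift_gen //; apply: UTq_comul_rel. Qed.
Lemma UTq_comul_genE (i j : 'I_n) :
  UTq_comul (a i j) = \sum_(k < n) (a i k ⊗ a k j)%R.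
Proof.
rewrite UTq_comul_emb Tq_comulE [LHS]linear_sum.
by apply: eq_bigr => k _; apply: tensor_map_pure.
Qed.
Lemma UTq_comulE (i j : 'I_n) :
  UTq_comul (a i j) = \sum_(k < n | (i <= k <= j)%N) (a i k ⊗ a k j)%R.
Proof.
rewrite UTq_comul_emb Tq_comulE -cogen_cond [LHS]linear_sum.
by apply: eq_bigr => k _; apply: tensor_map_pure.
Qed.
Lemma UTq_comul_detV : UTq_comul UTq_detV = UTq_detV ⊗ UTq_detV.
Proof. by rewrite [LHS]pres_lift_gen //; apply: UTq_comul_rel. Qed.

Local Notation Delta := UTq_comul_lr.

Lemma UTq_comul_lrE (i j : 'I_n) : Delta (a i j) = \sum_(k < n) (a i k ⊗ a k j)%R.
Proof. exact: UTq_comul_genE. Qed.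

Lemma UTq_comul_lrV : Delta UTq_detV = UTq_detV ⊗ UTq_detV.
Proof. exact: UTq_comul_detV. Qed.

Lemma UTq_comulA x :
  tensor_assoc (tensor_map Delta idfun (Delta x))
  = tensor_map idfun Delta (Delta x).
Proof.
move: x; apply: (@UTq_ext _
  (@tensor_assoc K UTq UTq UTq \o tensor_map Delta idfun \o Delta)
  (tensor_map idfun Delta \o Delta)) => [i j|]; last first.
  change (tensor_assoc (tensor_map Delta idfun (Delta UTq_detV))
          = tensor_map idfun Delta (Delta UTq_detV)).
  rewrite UTq_comul_lrV !tensor_map_pure /= UTq_comul_detV.
  exact: tensor_assocE.
change (tensor_assoc (tensor_map Delta idfun (Delta (a i j)))
        = tensor_map idfun Delta (Delta (a i j))).
rewrite UTq_comul_lrE [tensor_map Delta idfun _]linear_sum.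
rewrite [tensor_assoc _]linear_sum [RHS]linear_sum.
transitivity (\sum_k \sum_l (a i l ⊗ (a l k ⊗ a k j))%R).
  apply: eq_bigr => k _.
  apply: etrans (congr1 (@tensor_assoc _ _ _ _)
    (tensor_map_pure Delta idfun (a i k) (a k j))) _.
  rewrite [X in X ⊗ _]UTq_comul_lrE pure_suml [LHS]linear_sum.
  by apply: eq_bigr => l _; apply: tensor_assocE.
rewrite exchange_big; apply: eq_bigr => l _.
by rewrite [RHS]tensor_map_pure [X in _ ⊗ X]UTq_comul_lrE pure_sumr.
Qed.

Definition lcounit (x y : UTq) : UTq := UTq_counit x *: y.
Definition rcounit (x y : UTq) : UTq := UTq_counit y *: x.

Lemma lcounit_bilin : bilin lcounit.
Proof.
split=> [y|x] c x' y'; rewrite /lcounit.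
  by rewrite linearP scalerDl scalerA.
by rewrite scalerDr !scalerA mulrC.
Qed.
Lemma rcounit_bilin : bilin rcounit.
Proof.
split=> [y|x] c x' y'; rewrite /rcounit.
  by rewrite scalerDr !scalerA mulrC.
by rewrite linearP scalerDl scalerA.
Qed.
Lemma lcounit_monoid : monoid_morphism (tlift lcounit).
Proof.
apply: tlift_monoid => [||x x' y y']; first exact: lcounit_bilin.
  by rewrite /lcounit rmorph1 scale1r.
by rewrite /lcounit rmorphM -scalerAl -scalerAr scalerA.
Qed.
Lemma rcounit_monoid : monoid_morphism (tlift rcounit).
Proof.
apply: tlift_monoid => [||x x' y y']; first exact: rcounit_bilin.
  by rewrite /rcounit rmorph1 scale1r.
by rewrite /rcounit rmorphM -scalerAl -scalerAr scalerA.
Qed.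
Let lcounit_lr : {lrmorphism UTq ⊗ UTq -> UTq} :=
  HB.pack (tlift lcounit)
    (GRing.isLinear.Build K (UTq ⊗ UTq)%type UTq *:%R _
       (tlift_linear lcounit_bilin))
    (GRing.isMonoidMorphism.Build (UTq ⊗ UTq)%type UTq _ lcounit_monoid).
Let rcounit_lr : {lrmorphism UTq ⊗ UTq -> UTq} :=
  HB.pack (tlift rcounit)
    (GRing.isLinear.Build K (UTq ⊗ UTq)%type UTq *:%R _
       (tlift_linear rcounit_bilin))
    (GRing.isMonoidMorphism.Build (UTq ⊗ UTq)%type UTq _ rcounit_monoid).

Lemma UTq_counitl x : tlift (fun a b => UTq_counit a *: b) (Delta x) = x.
Proof.
move: x; apply: (@UTq_ext UTq (lcounit_lr \o Delta) idfun) => [i j|] /=; last first.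
  rewrite UTq_comul_detV tlift_pure; last exact: lcounit_bilin.
  by rewrite /lcounit UTq_counit_detV scale1r.
rewrite [UTq_comul _]UTq_comul_lrE -[tlift _]/(lcounit_lr : _ -> _) linear_sum /=.
rewrite (bigD1 i) //= big1 => [|k ki];
  rewrite tlift_pure; try exact: lcounit_bilin.
  by rewrite /lcounit UTq_counitE eqxx scale1r addr0.
by rewrite /lcounit UTq_counitE eq_sym (negPf ki) scale0r.
Qed.

Lemma UTq_counitr x : tlift (fun a b => UTq_counit b *: a) (Delta x) = x.
Proof.
move: x; apply: (@UTq_ext UTq (rcounit_lr \o Delta) idfun) => [i j|] /=; last first.
  rewrite UTq_comul_detV tlift_pure; last exact: rcounit_bilin.
  by rewrite /rcounit UTq_counit_detV scale1r.
rewrite [UTq_comul _]UTq_comul_lrE -[tlift _]/(rcounit_lr : _ -> _) linear_sum /=.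
rewrite (bigD1 j) //= big1 => [|k kj];
  rewrite tlift_pure; try exact: rcounit_bilin.
  by rewrite /rcounit UTq_counitE eqxx scale1r addr0.
by rewrite /rcounit UTq_counitE (negPf kj) scale0r.
Qed.

Definition UTq_bialgebra : bialgebra UTq :=
  Bialgebra UTq_comulA UTq_counitl UTq_counitr.

End UT.

(* Main.v *)
From HB Require Import structures.
Require Import Defs.
From mathcomp Require Import all_boot all_algebra.

Set Implicit Arguments.
Unset Strict Implicit.
Unset Printing Implicit Defensive.

Import GRing.Theory.
Local Open Scope ring_scope.

(* The antipode must send [a_ij] to the entries of the inverse [X] of the     *)
(* matrix [(a_ij)], which exists because this matrix is triangular with       *)
(* invertible diagonal. For fixed [b = a_il] the relations say that            *)
(* [(a_jk b) = C (b a_jk) D] with [C], [D] diagonal over [K]; multiplying by   *)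
(* [X] on both sides, the entries of [X] also q-commute with [b], and doing    *)
(* it once more with [b] an entry of [X] gives the relations of the opposite   *)
(* algebra. So [a_ij |-> X_ij] extends to an anti-endomorphism, for which the  *)
(* antipode identities need only be checked on generators.                    *)

(** Since [Delta] acts on [UTq_mx] as matrix multiplication, the antipode identities at the [a_ij]
    say exactly that [X] is a two-sided inverse of [UTq_mx]. Such an [X] comes from
    [upper_triangular_inverse], as each [a_ii] is a factor of the invertible [UTq_det]. Two uses of
    [inverse_mx_qcommute], in [inverse_gen_tw] and [inverse_tw], make [a_ij |-> X_ij] an algebra map
    into [U^c]; by [Tq_antipode_det] it extends with [det^-1 |-> det]. Finally [antipode_atD],
    [antipode_atC] and [antipode_atM] carry the identities from generators to all of [U]. *)

Section ConverseAlgebra.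
Variables (K : fieldType) (A : algType K).

(** [pres_lift] needs a [K]-algebra as target; with [A^c] as target it produces
    anti-homomorphisms. *)
HB.instance Definition _ := GRing.Zmodule_isLmodule.Build K A^c
  (@scalerA K A) (@scale1r K A) (@scalerDr K A)
  (fun v a b => @scalerDl K A v a b).

Lemma converse_scalerAl (c : K) (x y : A^c) : c *: (x * y) = (c *: x) * y.
Proof. exact: (@scalerAr K A). Qed.
HB.instance Definition _ :=
  GRing.Lmodule_isLalgebra.Build K A^c converse_scalerAl.

Lemma converse_scalerAr (c : K) (x y : A^c) : c *: (x * y) = x * (c *: y).
Proof. exact: (@scalerAl K A). Qed.
HB.instance Definition _ :=
  GRing.Lalgebra_isAlgebra.Build K A^c converse_scalerAr.

End ConverseAlgebra.

(** * Inverses in noncommutative rings *)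

Section Inverses.
Variable R : nzRingType.

Definition two_sided_inverse (x y : R) := x * y = 1 /\ y * x = 1.

(** A product taken in [R^c] is the reversed product in [R], the order needed to invert a product of
    factors that need not commute. *)
Lemma converse_prod_inverse (I : Type) (s : seq I) (F G : I -> R) :
    (forall i, two_sided_inverse (F i) (G i)) ->
  two_sided_inverse (\prod_(i <- s) F i) (\prod_(i <- s) (G i : R^c)).
Proof.
move=> FG; rewrite /two_sided_inverse; elim: s => [|i s [IH1 IH2]].
  by rewrite !big_nil mul1r.
have [FG1 GF1] := FG i.
rewrite !big_cons [(G i : R^c) * _]/(@GRing.mul R _ _).
split; first by rewrite mulrA -[F i * _ * _]mulrA IH1 mulr1.
by rewrite mulrA -[X in X * _]mulrA GF1 mulr1.
Qed.

Lemma prod_factor_inverse (I : finType) (F : I -> R) (d : R) (i : I) :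
    (forall j k, GRing.comm (F j) (F k)) ->
    two_sided_inverse (\prod_j F j) d ->
  exists u, two_sided_inverse (F i) u.
Proof.
move=> Fcomm [Fd dF].
have : i \in index_enum I by rewrite mem_index_enum.
case/splitPr defI: _ / => [s1 s2].
move: Fd dF; rewrite defI big_cat big_cons /=.
set P := \prod_(j <- s1) _; set Q := \prod_(j <- s2) _ => Fd dF.
have FP : F i * P = P * F i by apply: commr_prod.
have FQ : F i * Q = Q * F i by apply: commr_prod.
(* A left and a right inverse of [F i] are found separately; by associativity they coincide. *)
have uF : d * P * Q * F i = 1 by rewrite -mulrA -FQ -mulrA.
have Fv : F i * (P * Q * d) = 1 by rewrite !mulrA FP -[P * _ * Q]mulrA.
exists (P * Q * d); split=> //.
by rewrite -[P * Q * d]mul1r -uF -[d * P * Q * _ * _]mulrA Fv mulr1.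
Qed.

(** Induction on the size, splitting off the first row and column. [is_trig_mx] means lower
    triangular, hence the transposes. *)
Lemma upper_triangular_inverse n (M : 'M[R]_n) :
    is_trig_mx M^T -> (forall i, exists u, two_sided_inverse (M i i) u) ->
  exists X : 'M[R]_n, [/\ is_trig_mx X^T, X *m M = 1%:M & M *m X = 1%:M].
Proof.
elim: n M => [|n IH] M Mtri Mdiag.
  exists 0; split; first by apply/is_trig_mxP => -[].
    by rewrite mul0mx flatmx0.
  by rewrite mulmx0 flatmx0.
rewrite -[n.+1]/(1 + n)%N in M Mtri Mdiag *.
rewrite -[M]submxK tr_block_mx is_trig_block_mx // in Mtri.
have /and3P[/eqP M10 _ Mdr] := Mtri.
have {}M10 : dlsubmx M = 0 by rewrite -[LHS]trmxK M10 trmx0.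
have [i|X [Xtri XM MX]] := IH _ Mdr.
  by have [u Mu] := Mdiag (rshift 1 i); exists u; rewrite !mxE.
have [u [Mu uM]] := Mdiag (lshift n ord0).
have Mul : ulsubmx M *m u%:M = 1%:M.
  by apply/matrixP => i j; rewrite !ord1 !mxE big_ord1 !mxE Mu.
have ulM : u%:M *m ulsubmx M = 1%:M.
  by apply/matrixP => i j; rewrite !ord1 !mxE big_ord1 !mxE uM.
(* The upper right block is the solution [Z] of [ulsubmx M *m Z + ursubmx M *m X = 0]. *)
exists (block_mx u%:M (- (u%:M *m ursubmx M *m X)) 0 X); split.
- by rewrite tr_block_mx is_trig_block_mx // trmx0 eqxx Xtri tr_scalar_mx
    scalar_mx_is_trig.
- rewrite -[M in _ *m M]submxK M10 mulmx_block !mulmx0 !mul0mx addr0 add0r ulM.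
  by rewrite mulNmx -(mulmxA _ X) XM mulmx1 subrr !add0r -scalar_mx_block.
- rewrite -[M in M *m _]submxK M10 mulmx_block !mulmx0 !mul0mx addr0 !add0r.
  by rewrite Mul mulmxN !mulmxA Mul mul1mx addNr MX -scalar_mx_block.
Qed.

End Inverses.

(** * Transfer of q-commutation to the inverse matrix *)

Lemma inverse_mx_qcommute (K : fieldType) (A : algType K) (n : nat)
    (M X : 'M[A]_n) (b : A) (c d c' d' : 'I_n -> K) :
    M *m X = 1%:M -> X *m M = 1%:M ->
    (forall i, c i * c' i = 1) -> (forall i, d i * d' i = 1) ->
    (forall i j, M i j * b = (c i * d j) *: (b * M i j)) ->
  forall i j, X i j * b = (c' j * d' i) *: (b * X i j).
Proof.
move=> MX XM cc' dd' Mb.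
(* [Y] is [D^-1 (b X) C^-1], where [C], [D] are the diagonal matrices of [c], [d]. From
   [M b = C (b M) D] follows [M Y = b], whence [X b = Y]. *)
pose Y := \matrix_(i, j) ((c' j * d' i) *: (b * X i j)).
have MY : M *m Y = b%:M.
  apply/matrixP => i k; rewrite !mxE.
  transitivity ((c i * c' k) *: (b * (M *m X) i k)).
    rewrite mxE mulr_sumr scaler_sumr; apply: eq_bigr => j _.
    rewrite mxE -scalerAr [M i j * _]mulrA Mb -scalerAl scalerA -[b * _ * _]mulrA; congr (_ *: _).
    by rewrite mulrACA [d' j * _]mulrC dd' mulr1 mulrC.
  rewrite MX mxE; case: eqP => [->|_]; last by rewrite mulr0 scaler0.
  by rewrite cc' scale1r mulr1.
move=> i j.
have /matrixP/(_ i j) : X *m b%:M = Y by rewrite -MY mulmxA XM mul1mx.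
rewrite !mxE => <-; rewrite (bigD1 j) //= mxE eqxx mulr1n big1 ?addr0 // => k kj.
by rewrite mxE (negPf kj) mulr0.
Qed.

(** * Antipode identities on sums and products *)

Section AntipodeMultiplicative.
Variables (K : fieldType) (A : algType K) (H : bialgebra A) (S : {linear A -> A}).
Hypothesis SM : forall x y, S (x * y) = S y * S x.

Definition antipode_at (x : A) : Prop :=
  tlift (fun a b => S a * b) (comul H x) = (counit H x)%:A /\
  tlift (fun a b => a * S b) (comul H x) = (counit H x)%:A.

Lemma antipode_bilinl : bilin (fun a b => S a * b).
Proof.
split=> [b|a] c x y; first by rewrite linearP mulrDl scalerAl.
by rewrite mulrDr scalerAr.
Qed.

Lemma antipode_bilinr : bilin (fun a b => a * S b).
Proof.
split=> [b|a] c x y; first by rewrite mulrDl scalerAl.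
by rewrite linearP mulrDr scalerAr.
Qed.

Lemma antipode_atD x y : antipode_at x -> antipode_at y -> antipode_at (x + y).
Proof.
have Dl (f : A -> A -> A) u v : bilin f -> tlift f (u + v) = tlift f u + tlift f v.
  by move=> fb; have := tlift_linear fb 1 u v; rewrite !scale1r.
move=> [xl xr] [yl yr]; rewrite /antipode_at !rmorphD scalerDl.
rewrite Dl; last exact: antipode_bilinl.
rewrite Dl; last exact: antipode_bilinr.
by rewrite xl xr yl yr.
Qed.

Lemma antipode_atC c : S 1 = 1 -> antipode_at c%:A.
Proof.
move=> S1; rewrite /antipode_at !linearZ !rmorph1 /=.
rewrite -[c *: 1](pureZl c (1 : A) (1 : A)) !tlift_pure; last first.
- exact: antipode_bilinl.
- exact: antipode_bilinr.
by rewrite linearZ /= S1 !mulr1 (_ : c *: (1 : K^o) = c) //; apply: mulr1.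
Qed.

(** As [S] reverses products, [S(x1 y1) x2 y2 = S(y1) (S(x1) x2) y2]: the inner factor collapses to
    the scalar [counit H x], then the outer one to [counit H y]. On the other side [y] collapses
    first. *)
Lemma antipode_atM x y : antipode_at x -> antipode_at y -> antipode_at (x * y).
Proof.
have mull (z : A) : linear (fun w : A => w * z).
  by move=> c u v; rewrite mulrDl scalerAl.
have mulr (z : A) : linear (fun w : A => z * w).
  by move=> c u v; rewrite mulrDr scalerAr.
have sca (e : K) : linear (fun w : A => e *: w).
  by move=> c u v; rewrite scalerDr !scalerA mulrC.
have Ll := tlift_linear antipode_bilinl.
have Lr := tlift_linear antipode_bilinr.
have DM : comul H (x * y) = comul H x * comul H y by apply: rmorphM.
have eM : counit H (x * y) = counit H x * counit H y by apply: rmorphM.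
move=> [xl xr] [yl yr]; split; rewrite DM eM -scalerA.
  have inner (t : (A ⊗ A)%type) a b :
      tlift (fun a b => S a * b) (t * (a ⊗ b)) = S a * tlift (fun a b => S a * b) t * b.
    apply: (tensor_ext (f := fun t => tlift _ (t * _))
                       (g := fun t => _ * tlift _ t * _)) t => [||v w].
    - exact: linear_comp2 (tmul_linearl _) Ll.
    - exact: linear_comp2 (linear_comp2 Ll (mulr _)) (mull _).
    rewrite tensor_mulE !(tlift_pure antipode_bilinl) SM.
    by rewrite !mulrA.
  rewrite -yl; move: (comul H y).
  apply: (tensor_ext (f := fun t => tlift _ (_ * t))
                     (g := fun t => _ *: tlift _ t)) => [||a b].
  - exact: linear_comp2 (tmul_linearr _) Ll.
  - exact: linear_comp2 Ll (sca _).
  by rewrite inner xl (tlift_pure antipode_bilinl) -scalerAr mulr1 -scalerAl.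
have inner (t : (A ⊗ A)%type) a b :
    tlift (fun a b => a * S b) ((a ⊗ b) * t) = a * tlift (fun a b => a * S b) t * S b.
  apply: (tensor_ext (f := fun t => tlift _ (_ * t))
                     (g := fun t => _ * tlift _ t * _)) t => [||v w].
  - exact: linear_comp2 (tmul_linearr _) Lr.
  - exact: linear_comp2 (linear_comp2 Lr (mulr _)) (mull _).
  rewrite tensor_mulE !(tlift_pure antipode_bilinr) SM.
  by rewrite !mulrA.
(* Here [comul H y] is the inner tensor, so the counits are swapped to leave [counit H x] next to
   [1]. *)
rewrite scalerA [_ * counit H y]mulrC -scalerA -xr; move: (comul H x).
apply: (tensor_ext (f := fun t => tlift _ (t * _))
                   (g := fun t => _ *: tlift _ t)) => [||a b].
- exact: linear_comp2 (tmul_linearl _) Lr.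
- exact: linear_comp2 Lr (sca _).
by rewrite inner yr (tlift_pure antipode_bilinr) -scalerAr mulr1 -scalerAl.
Qed.

End AntipodeMultiplicative.

(** * The antipode of [UTq] *)

Section UTqAntipode.
Variables (K : fieldType) (n : nat) (q : K).
Hypothesis q_neq0 : q != 0.

Local Notation U := (UTq n q).
Local Notation a := (@UTq_gen K n q).

Definition UTq_mx : 'M[U]_n := \matrix_(i, j) a i j.

Lemma UTq_tw (i j k l : 'I_n) :
  a j k * a i l = (tw q i j * tw q k l) *: (a i l * a j k).
Proof. by rewrite /UTq_gen -!rmorphM /= Tq_tw // linearZ. Qed.

Lemma UTq_diag_inverse i : exists u, two_sided_inverse (a i i) u.
Proof.
apply: (prod_factor_inverse (F := fun i => a i i) (d := UTq_detV n q)) => [j k|].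
  by rewrite /GRing.comm UTq_tw tw_inv // scale1r.
by split; rewrite -UTq_detE ?UTq_detK ?UTq_detVK.
Qed.

Lemma UTq_mx_inverse : exists X : 'M[U]_n,
  [/\ is_trig_mx X^T, X *m UTq_mx = 1%:M & UTq_mx *m X = 1%:M].
Proof.
apply: upper_triangular_inverse => [|i]; last first.
  by rewrite mxE; apply: UTq_diag_inverse.
by apply/is_trig_mxP => i j ij; rewrite !mxE UTq_gen0.
Qed.

Variable X : 'M[U]_n.
Hypotheses (Xtri : is_trig_mx X^T).
Hypotheses (XM : X *m UTq_mx = 1%:M) (MX : UTq_mx *m X = 1%:M).

Lemma inverse_lower0 (i j : 'I_n) : (j < i)%N -> X i j = 0.
Proof. by move=> ji; have /is_trig_mxP/(_ _ _ ji) := Xtri; rewrite mxE. Qed.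

Lemma inverse_gen_tw (i j p r : 'I_n) :
  X i j * a p r = (tw q j p * tw q r i) *: (a p r * X i j).
Proof.
apply: (inverse_mx_qcommute (c := tw q p) (d := fun k : 'I_n => tw q k r)
          (c' := fun k : 'I_n => tw q k p) (d' := tw q r) MX XM) => [k|k|k l].
- exact: tw_inv.
- exact: tw_inv.
- by rewrite mxE UTq_tw.
Qed.

(** Now [b] is the entry [X j k], and [inverse_gen_tw] read backwards supplies the hypothesis.
    Compared with [UTq_tw], the factors on both sides are reversed while the scalar is the same. *)
Lemma inverse_tw (i j k l : 'I_n) :
  X i l * X j k = (tw q i j * tw q k l) *: (X j k * X i l).
Proof.
rewrite [tw q i j * _]mulrC.
apply: (inverse_mx_qcommute (c := fun p : 'I_n => tw q p k) (d := tw q j)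
          (c' := tw q k) (d' := fun r : 'I_n => tw q r j) MX XM) => [p|p|p r].
- exact: tw_inv.
- exact: tw_inv.
- by rewrite mxE inverse_gen_tw scalerA mulrACA !tw_inv // mulr1 scale1r.
Qed.

Definition Tq_antipode_gen (x : Tq_index n) : U^c := X (val x).1 (val x).2.
Definition Tq_antipode : Tq n q -> U^c := pres_lift Tq_antipode_gen.

(** In [U^c], [inverse_tw] takes the form of [Tq_tw], and each defining relation is a case of it. *)
Lemma Tq_antipode_rel s t : Tq_rel q s t ->
  term_eval Tq_antipode_gen s = term_eval Tq_antipode_gen t.
Proof.
have tw_conv (i j k l : 'I_n) : (X j k : U^c) * (X i l : U^c)
    = (tw q i j * tw q k l) *: ((X i l : U^c) * (X j k : U^c)) by exact: inverse_tw.
case=> {s t} [i j k ik jk ij|j k l jk jl kl|i j k l ik jl ij kl|i j k l jk il ij kl];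
  rewrite /= /Tq_antipode_gen /= tw_conv -?scalerAl ?mul1r /tw ?ltnn ?ij ?kl.
- by rewrite mulr1.
- by rewrite mul1r.
- by rewrite ltnNge ltnW //= mulVf // scale1r.
- by rewrite expr2.
Qed.

Lemma Tq_antipode_linear : linear Tq_antipode.
Proof. exact/pres_lift_linear/Tq_antipode_rel. Qed.

Lemma Tq_antipode_monoid : monoid_morphism Tq_antipode.
Proof.
split; first exact/pres_lift1/Tq_antipode_rel.
exact/pres_liftM/Tq_antipode_rel.
Qed.

Lemma Tq_antipodeE i j : Tq_antipode (Tq_gen q i j) = X i j.
Proof.
have [ij|ji] := leqP i j.
  by rewrite Tq_genE [LHS]pres_lift_gen //; apply: Tq_antipode_rel.
rewrite Tq_gen0 // inverse_lower0 //.
by have := Tq_antipode_linear (-1) 0 0; rewrite !scaleN1r !addNr.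
Qed.

(** Both matrices are upper triangular, so only the term [k = i] survives in a diagonal entry of
    either product. *)
Lemma inverse_diag i : two_sided_inverse (a i i) (X i i).
Proof.
split.
  have /matrixP/(_ i i) := MX; rewrite !mxE eqxx mulr1n => <-.
  rewrite (bigD1 i) //= mxE big1 ?addr0 // => k; rewrite mxE neq_ltn.
  by case/orP=> ki; [rewrite UTq_gen0 ?mul0r | rewrite inverse_lower0 ?mulr0].
have /matrixP/(_ i i) := XM; rewrite !mxE eqxx mulr1n => <-.
rewrite (bigD1 i) //= mxE big1 ?addr0 // => k; rewrite mxE neq_ltn.
by case/orP=> ki; [rewrite inverse_lower0 ?mul0r | rewrite UTq_gen0 ?mulr0].
Qed.

(** This gives the two localization relations for the choice [det^-1 |-> det]. *)
Lemma Tq_antipode_det :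
  two_sided_inverse (UTq_det n q) (Tq_antipode (Tq_det n q)).
Proof.
rewrite UTq_detE /Tq_det (big_morph _ Tq_antipode_monoid.2 Tq_antipode_monoid.1).
under [X in two_sided_inverse _ X]eq_bigr do rewrite Tq_antipodeE.
exact/converse_prod_inverse/inverse_diag.
Qed.

Definition UTq_antipode : U -> U^c :=
  pres_lift (loc_lift_gen Tq_antipode (UTq_det n q : U^c)).

Lemma UTq_antipode_rel s t : loc_rel (Tq_det n q) s t ->
  term_eval (loc_lift_gen Tq_antipode (UTq_det n q : U^c)) s
  = term_eval (loc_lift_gen Tq_antipode (UTq_det n q : U^c)) t.
Proof.
have [dS Sd] := Tq_antipode_det.
by apply: loc_lift_rel; [exact: Tq_antipode_linear | exact: Tq_antipode_monoid | |].
Qed.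

(** [U] and [U^c] have the same underlying module, so linearity survives the change of target, while
    multiplicativity turns into [UTq_antipodeM]. *)
Lemma UTq_antipode_linear : linear (UTq_antipode : U -> U).
Proof. exact: (pres_lift_linear UTq_antipode_rel). Qed.

Definition UTq_antipode_lin : {linear U -> U} :=
  HB.pack (UTq_antipode : U -> U)
    (GRing.isLinear.Build K U U *:%R (UTq_antipode : U -> U) UTq_antipode_linear).

Lemma UTq_antipodeM x y :
  UTq_antipode_lin (x * y) = UTq_antipode_lin y * UTq_antipode_lin x.
Proof. exact: (pres_liftM UTq_antipode_rel). Qed.

Lemma UTq_antipode1 : UTq_antipode_lin 1 = 1.
Proof. exact: (pres_lift1 UTq_antipode_rel). Qed.

Lemma UTq_antipodeE i j : UTq_antipode_lin (a i j) = X i j.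
Proof.
rewrite -Tq_antipodeE; exact: (pres_lift_gen UTq_antipode_rel).
Qed.

Lemma UTq_antipode_detV : UTq_antipode_lin (UTq_detV n q) = UTq_det n q.
Proof. exact: (pres_lift_gen UTq_antipode_rel). Qed.

Lemma UTq_antipodeP : is_antipode (UTq_bialgebra n q_neq0) UTq_antipode_lin.
Proof.
have Sl := antipode_bilinl UTq_antipode_lin.
have Sr := antipode_bilinr UTq_antipode_lin.
apply: UTq_ind => [i j||c|x y|x y].
- rewrite [comul _ _]UTq_comul_lrE [counit _ _]UTq_counitE.
  pose l : {linear (U ⊗ U)%type -> U} := HB.pack (tlift _)
    (GRing.isLinear.Build K (U ⊗ U)%type U *:%R _ (tlift_linear Sl)).
  pose r : {linear (U ⊗ U)%type -> U} := HB.pack (tlift _)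
    (GRing.isLinear.Build K (U ⊗ U)%type U *:%R _ (tlift_linear Sr)).
  rewrite -[tlift _]/(l : _ -> _) -[tlift (fun a b => a * _)]/(r : _ -> _).
  (* Each side is now an entry of [X *m UTq_mx = 1%:M] or of [UTq_mx *m X = 1%:M]. *)
  rewrite !linear_sum /= scaler_nat; split.
    have /matrixP/(_ i j) := XM; rewrite !mxE => <-.
    by apply: eq_bigr => k _; rewrite (tlift_pure Sl) UTq_antipodeE mxE.
  have /matrixP/(_ i j) := MX; rewrite !mxE => <-.
  by apply: eq_bigr => k _; rewrite (tlift_pure Sr) UTq_antipodeE mxE.
- rewrite [comul _ _]UTq_comul_lrV [counit _ _]UTq_counit_detV scale1r.
  rewrite (tlift_pure Sl) (tlift_pure Sr) UTq_antipode_detV.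
  by split; [exact: UTq_detK | exact: UTq_detVK].
- exact/antipode_atC/UTq_antipode1.
- exact: antipode_atD.
- exact/antipode_atM/UTq_antipodeM.
Qed.

End UTqAntipode.

Theorem theorem3p4 (K : fieldType) (charK : 2%N \notin [pchar K])
    (n : nat) (n_ge2 : (2 <= n)%N) (q : K) (q_neq0 : q != 0) :
  is_hopf (UTq_bialgebra n q_neq0).
Proof.
have [X [Xtri XM MX]] := UTq_mx_inverse n q_neq0.
by exists (UTq_antipode_lin q_neq0 Xtri XM MX); apply: UTq_antipodeP.
Qed.
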